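(* Let $\mathbb{K}$ be a field and let $H$ be a numerical semigroup with embedding dimension $n\ge 3$, minimally generated by $a_0,a_1,\ldots,a_{n-1}$, where $a_0=\min(H\setminus\{0\})$. Let $S=\mathbb{K}[X_0,\ldots,X_{n-1}]$ and let $I_H$ be the kernel of the $\mathbb{K}$-algebra homomorphism $\varphi:S\to \mathbb{K}[t]$, $\varphi(X_i)=t^{a_i}$. Suppose that $a_0/2+1\le n$. Then the following conditions are equivalent. (1) There exist a permutation $\pi$ of $\{0,1,\ldots,n-1\}$ and integers $l_0,l_1,\ldots,l_{n-1},m_0,m_1,\ldots,m_{n-1}>0$ such that, writing $Y_s=X_{\pi(s)}$, $$I_H=\mathrm{I}_2\begin{pmatrix} Y_0^{l_0}&Y_1^{l_1}&\cdots&Y_{n-2}^{l_{n-2}}&Y_{n-1}^{l_{n-1}}\\ Y_1^{m_1}&Y_2^{m_2}&\cdots&Y_{n-1}^{m_{n-1}}&Y_0^{m_0}\end{pmatrix}.$$ (2) The set $\mathrm{PF}(H)$ of pseudo-Frobenius numbers of $H$ forms an arithmetic sequence of length $n-1$, i.e. there exist integers $h$ and $\alpha\neq 0$ with $\mathrm{PF}(H)=\{h+\alpha,h+2\alpha,\ldots,h+(n-1)\alpha\}$.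
   Context: A numerical semigroup is a submonoid $H$ of $(\mathbb{Z}_{\ge 0},+)$ with finite complement in $\mathbb{Z}_{\ge0}$; its embedding dimension is the number of elements of its unique minimal generating set. A pseudo-Frobenius number of $H$ is an integer $p\in\mathbb{Z}_{\ge0}\setminus H$ such that $p+h\in H$ for all $h\in H$ with $h>0$; $\mathrm{PF}(H)$ is the set of all of them. For a matrix $M$ with entries in $S$, $\mathrm{I}_2(M)$ is the ideal of $S$ generated by the $2\times 2$ minors of $M$. *)

(* Defs.v *)
From HB Require Import structures.
From mathcomp Require Import all_boot all_order all_fingroup all_algebra.
From mathcomp Require Import mpoly.

Set Implicit Arguments.
Unset Strict Implicit.
Unset Printing Implicit Defensive.

Import GRing.Theory.
Local Open Scope ring_scope.

(* Boolean membership loses no generality: a cofinite subset of [nat] is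
   decidable. *)
Definition numerical_semigroup (H : {pred nat}) : Prop :=
  [/\ 0%N \in H,
      forall x y : nat, x \in H -> y \in H -> (x + y)%N \in H
    & exists N : nat, forall x : nat, (N <= x)%N -> x \in H].

Definition in_span n (a : 'I_n -> nat) (J : {set 'I_n}) (h : nat) : Prop :=
  exists c : 'I_n -> nat, h = (\sum_(i in J) c i * a i)%N.

Definition generates (H : {pred nat}) n (a : 'I_n -> nat) (J : {set 'I_n})
  : Prop :=
  forall h : nat, h \in H <-> in_span a J h.

(* Minimality forces the [a i] to be nonzero and pairwise distinct, so [n] is
   the embedding dimension of [H]. *)
Definition minimally_generated_by (H : {pred nat}) n (a : 'I_n -> nat) : Prop :=
  generates H a [set: 'I_n]
  /\ forall J : {set 'I_n}, J \proper [set: 'I_n] -> ~ generates H a J.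

Definition is_least_nonzero (H : {pred nat}) (m : nat) : Prop :=
  [/\ m \in H, (0 < m)%N
    & forall h : nat, h \in H -> (0 < h)%N -> (m <= h)%N].

Definition pseudo_frobenius (H : {pred nat}) (p : nat) : Prop :=
  p \notin H /\ forall h : nat, h \in H -> (0 < h)%N -> (p + h)%N \in H.

Definition in_ideal_generated (R : comNzRingType) (G : R -> Prop) (x : R)
  : Prop :=
  exists s : seq (R * R),
    (forall u : R * R, u \in s -> G u.2) /\ x = \sum_(u <- s) u.1 * u.2.

Definition is_minor (R : comNzRingType) (k p q : nat) (M : 'M[R]_(p, q)) (d : R)
  : Prop :=
  exists (f : 'I_k -> 'I_p) (g : 'I_k -> 'I_q),
    [/\ {homo f : i j / (i < j)%N}, {homo g : i j / (i < j)%N}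
      & d = \det (mxsub f g M)].

Definition in_minor_ideal (R : comNzRingType) (k p q : nat) (M : 'M[R]_(p, q))
  : R -> Prop :=
  in_ideal_generated (is_minor k M).

Definition semigroup_map (K : fieldType) n (a : 'I_n -> nat)
  (f : {mpoly K[n]}) : {poly K} :=
  mmap (@polyC K) (fun i => 'X^(a i)) f.

Definition in_semigroup_ideal (K : fieldType) n (a : 'I_n -> nat)
  (f : {mpoly K[n]}) : Prop :=
  semigroup_map a f = 0.

(* [ordS] is the cyclic successor on ['I_n], so the last column is
   (Y_(n-1) ^ l_(n-1), Y_0 ^ m_0). *)
Definition cyclic_matrix (K : fieldType) n (s : 'S_n) (l m : 'I_n -> nat)
  : 'M[{mpoly K[n]}]_(2, n) :=
  \matrix_(i < 2, j < n)
    if i == 0 then 'X_(s j) ^+ l j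
    else 'X_(s (ordS j)) ^+ m (ordS j).

(* Main.v *)
(** Write [b j] for the degree of [Y_j]. If [I_H] is the determinantal ideal, the
    minors force [m (j + 1) * b (j + 1) - l j * b j] to be a constant [d], and
    two monomials of the same degree differ by flipping columns between their
    top and bottom entries with total flip number zero. Then the pseudo-Frobenius
    numbers are [p_k = \sum_j (l j - 1) * b j + k * d] for [0 < k < n]: a monomial
    of degree [p_k + \sum_j b j] always misses a variable, so [p_k] is not in [H],
    and reducing a monomial of degree [p + b 0] to its normal form for the moves
    [Y_j^(l j) Y_(i+1)^(m (i+1)) -> Y_i^(l i) Y_(j+1)^(m (j+1))], [i < j], shows that
    every pseudo-Frobenius number [p] lies below some [p_k].

    Conversely let [PF(H)] be arithmetic with difference [alpha] and put
    [e = a_0 <= 2 n - 2]. Then [alpha] is a unit modulo [e]; let [f z] be the least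
    [t] with [z * alpha + t * e] in [H]. It is constant on the [n - 1] consecutive
    residues of the maximal Apery elements, and the [e - n <= n - 2] remaining
    nonzero residues split into two sides, [1 .. rho] and [- sigma .. - 1], on each
    of which [f] is monotone and symmetric. Comparing lengths of plateaus of [f]
    with the number of generators shows that the generators on each side are
    exactly the first arguments [t_j] lying at offset [j] in a plateau, whence
    [t_(j+1) = c t_j + 1] and [f t_(j+1) = c f t_j]: these relations are the columns
    of the matrix. Normal forms are mixed radix expansions with respect to the
    [t_j], so they are determined by their degree, and [I_H] is generated by the
    minors. *)

From Stdlib Require Import FunctionalExtensionality ClassicalEpsilon.
Require Import Defs.
From mathcomp Require Import all_boot all_order all_fingroup all_algebra.
From mathcomp Require Import mpoly zify ring lra.

Set Implicit Arguments.
Unset Strict Implicit.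
Unset Printing Implicit Defensive.

Import Order.TTheory GRing.Theory Num.Theory.
Local Open Scope ring_scope.

(** * Plateaus *)

(** One side of the Apery function, read outwards from 0. Beyond [rho] it stays at the value [F] of
    the maximal Apery elements; partners express that every Apery element lies below a maximal
    one. *)
Record plateau_function (g : nat -> int) (rho N : nat) (F : int) : Prop :=
  PlateauFunction {
  plateau_size : (2 * rho + 1 <= N)%N;
  plateau0 : g 0%N = 0;
  plateau_top_gt0 : 0 < F;
  plateau_gt0 : forall v, (0 < v <= rho)%N -> 0 < g v;
  plateau_sub : forall v w, (v + w <= N)%N -> g (v + w)%N <= g v + g w;
  plateau_top : forall v, (rho < v <= N)%N -> g v = F;
  plateau_partner : forall v, (0 < v <= rho)%N ->
    exists w, [/\ (0 < w <= rho)%N, (rho < v + w)%N & g v + g w = F]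
}.

Section Plateaus.

Variables (g : nat -> int) (rho N : nat) (F : int).
Hypothesis Pg : plateau_function g rho N F.

Let rhoN := plateau_size Pg.
Let g0 := plateau0 Pg.
Let F_gt0 := plateau_top_gt0 Pg.
Let g_gt0 := plateau_gt0 Pg.
Let g_sub := plateau_sub Pg.
Let g_top := plateau_top Pg.
Let g_partner := plateau_partner Pg.

Definition splits (v : nat) : Prop :=
  exists x y : nat, [/\ (0 < x)%N, (0 < y)%N, (x + y = v)%N & g x + g y = g v].

Lemma g_lt v : (v <= rho)%N -> g v < F.
Proof.
case: (posnP v) => [->|v0] lev; first by rewrite g0.
have [|w [w0 _ E]] := g_partner (v := v); first lia.
have := g_gt0 w0; lia.
Qed.

(** For a partner [w] of [v], the argument [v + 1 + w] is still on the top plateau, so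
    [F <= g (v + 1) + g w], whereas [g v + g w = F]. *)
Lemma g_step v : (v < N)%N -> g v <= g v.+1.
Proof.
move=> ltvN; have [lev|ltv] := leqP v.+1 rho; last first.
  rewrite (g_top (v := v.+1)); last lia.
  have [le|lt] := leqP v rho; first by have := g_lt le; lia.
  by rewrite g_top; lia.
case: (posnP v) => [->|v0]; first by rewrite g0; have := @g_gt0 1%N; lia.
have [|w [w0 vw E]] := g_partner (v := v); first lia.
have := @g_sub v.+1 w; rewrite (g_top (v := (v.+1 + w)%N)); lia.
Qed.

Lemma g_mono v w : (v <= w <= N)%N -> g v <= g w.
Proof.
case/andP; elim: w => [|w IH]; first by rewrite leqn0 => /eqP->.
rewrite leq_eqVlt => /predU1P[-> //|vw] wN.
by apply: le_trans (IH _ _) (g_step _); lia.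
Qed.

(** A partner [w] satisfies [rho + 1 - v <= w], so monotonicity gives one inequality; subadditivity
    at [rho + 1] gives the other. *)
Lemma g_sym v : (0 < v <= rho)%N -> g v + g (rho.+1 - v)%N = F.
Proof.
move=> Hv; have [w [w0 vw E]] := g_partner Hv.
have := @g_mono (rho.+1 - v) w; have := @g_sub v (rho.+1 - v).
rewrite subnKC; last lia.
rewrite (g_top (v := rho.+1)); lia.
Qed.

(* As [g] is monotone, this says that [v] has offset at least [j] in the maximal
   interval of positive arguments on which [g] takes the value [g v]. *)
Definition flat (j v : nat) : bool := (j < v)%N && (g (v - j)%N == g v).

Lemma flatW i j v : (i <= j)%N -> (v <= N)%N -> flat j v -> flat i v.
Proof.
move=> ij vN /andP[jv /eqP E]; apply/andP; split; first lia.
have := @g_mono (v - j) (v - i); have := @g_mono (v - i) v; lia.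
Qed.

Lemma flat_pred j v : (v <= N)%N -> flat j.+1 v ->
  flat j v.-1 /\ g v.-1 = g v.
Proof.
move=> vN /andP[jv /eqP E].
have := @g_mono (v - j.+1) v.-1; have := @g_mono v.-1 v.
rewrite /flat; have -> : (v.-1 - j = v - j.+1)%N by lia.
rewrite E => h1 h2; have E1: g v.-1 = g v by lia.
by split=> //; rewrite E1 eqxx andbT; lia.
Qed.

(** If [j < x], then [g (x + y - j) <= g (x - j) + g y] forces [g (x - j) = g x]. If [x <= j], then
    [g (x + y) = g (x + y - j) <= g y], against [0 < g x]. *)
Lemma flat_splitl j x y : (0 < x)%N -> (0 < y)%N -> (x + y <= N)%N ->
  g x + g y = g (x + y)%N -> flat j (x + y) -> flat j x.
Proof.
move=> x0 y0 xyN E /andP[jxy /eqP Ej].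
have gp z : (0 < z <= N)%N -> 0 < g z.
  by move=> Hz; have [le|lt] := leqP z rho; [apply: g_gt0 | rewrite g_top]; lia.
have [ltjx|lexj] := ltnP j x.
  apply/andP; split=> //.
  have := @g_sub (x - j) y; have := @g_mono (x - j) x.
  have -> : (x - j + y = x + y - j)%N by lia.
  by rewrite Ej; lia.
have := @g_mono (x + y - j) y; have := gp x; lia.
Qed.

Lemma flat_split j x y : (0 < x)%N -> (0 < y)%N -> (x + y <= N)%N ->
  g x + g y = g (x + y)%N -> flat j (x + y) -> flat j x /\ flat j y.
Proof.
move=> x0 y0 xyN E fl; split; first exact: flat_splitl E fl.
by apply: (@flat_splitl _ y x); rewrite ?(addnC y) //; lia.
Qed.

(** The length of a longest plateau inside [1 .. rho], and 0 when [rho = 0]. *)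
Definition plateau_length : nat :=
  \max_(j < rho.+1 | [exists v : 'I_rho.+1, flat j v && (0 < v)%N]) j.+1.

Local Notation ell := plateau_length.

Lemma flat_le_ell j v : (v <= rho)%N -> flat j v -> (j < ell)%N.
Proof.
move=> vr fl; have jv: (j < v)%N by case/andP: fl.
have jr : (j < rho.+1)%N by lia.
have vr' : (v < rho.+1)%N by lia.
apply: (@leq_bigmax_cond _ _ (fun j : 'I_rho.+1 => j.+1) (Ordinal jr)).
by apply/existsP; exists (Ordinal vr'); rewrite /= fl; lia.
Qed.

Lemma ell_le : (ell <= rho)%N.
Proof.
apply/bigmax_leqP => j /existsP[v /andP[/andP[jv _] _]].
by have := ltn_ord v; lia.
Qed.

Lemma ell_flat j : (j < ell)%N -> exists2 v, (v <= rho)%N & flat j v.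
Proof.
move=> jl; case: (boolP [exists v : 'I_rho.+1, flat j v]).
  by case/existsP=> v fl; exists v => //; have := ltn_ord v; lia.
move/existsPn=> nfl; suff : (ell <= j)%N by rewrite leqNgt jl.
apply/bigmax_leqP => i /existsP[v /andP[fl _]]; rewrite ltnNge.
apply/negP => ji; case/negP: (nfl v); apply: flatW fl => //.
by have := ltn_ord v; lia.
Qed.

(** By symmetry [g y = F - g x = g (rho + 1 - x)], so [y] has offset at least [x + y - rho - 1] in
    its plateau. *)
Lemma top_split_le x y : (0 < x <= rho)%N -> (0 < y <= rho)%N ->
  (rho < x + y)%N -> g x + g y = F -> (x + y <= rho + ell)%N.
Proof.
move=> Hx Hy xy E; have := g_sym Hx => E2.
have fl : flat (x + y - rho.+1) y.
  rewrite /flat; have -> : (y - (x + y - rho.+1) = rho.+1 - x)%N by lia.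
  by apply/andP; split; [lia | apply/eqP; lia].
have := flat_le_ell _ fl; lia.
Qed.

(** With [i = v - rho - 1], take [y] at offset [i] in a plateau; the mirror image of [y - i]
    complements it. *)
Lemma splits_top v : (rho < v <= rho + ell)%N -> splits v.
Proof.
move=> Hv; have [|y yr fl] := @ell_flat (v - rho.+1); first lia.
have [ly /eqP E] := andP fl.
have Es : g (y - (v - rho.+1)) + g (rho.+1 - (y - (v - rho.+1))) = F.
  by apply: g_sym; lia.
exists (rho.+1 - (y - (v - rho.+1)))%N, y; split; [lia|lia|lia|].
by rewrite (g_top (v := v)); have := ell_le; lia.
Qed.

(** The [t_j] of the introductory comment; [find] returns [N + 1] when there is none. *)
Definition first_flat (j : nat) : nat := find (flat j) (iota 0 N.+1).

Local Notation t := first_flat.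

Lemma first_flat_min j v : (v < t j)%N -> ~~ flat j v.
Proof.
move=> lt; have := before_find 0%N lt; rewrite nth_iota ?add0n => [->//|].
by have := find_size (flat j) (iota 0 N.+1); rewrite size_iota => /(leq_trans lt).
Qed.

Lemma first_flatP j v : (v <= N)%N -> flat j v -> flat j (t j) /\ (t j <= v)%N.
Proof.
move=> vN fl; have le : (t j <= v)%N.
  by rewrite leqNgt; apply: contraL fl; exact: first_flat_min.
split=> //; have h : has (flat j) (iota 0 N.+1).
  by apply/hasP; exists v => //; rewrite mem_iota.
by have := nth_find 0%N h; rewrite nth_iota ?add0n //; move: le; rewrite /t; lia.
Qed.

(** The plateaus up to [rho] are too short for offset [j], so it first occurs on the top plateau,
    which begins at [rho + 1]. *)
Lemma first_flat_eq j : (ell <= j)%N -> (rho + j < N)%N -> t j = (rho + j.+1)%N.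
Proof.
move=> lj jN; have fl : flat j (rho + j.+1).
  apply/andP; split; first lia.
  by rewrite !g_top //; lia.
have [fl' le] := first_flatP jN (eq_rect _ (flat j) fl _ (addnS _ _)).
apply/eqP; rewrite eqn_leq addnS le /= ltnNge; apply/negP => tr.
have [tr'|tr'] := leqP (t j) rho; first by have := flat_le_ell tr' fl'; lia.
have /andP[lt /eqP] := fl'; rewrite [g (t j)]g_top; last lia.
have := @g_lt (t j - j); lia.
Qed.

Lemma first_flat_bound j : (rho + j < N)%N ->
  [/\ flat j (t j), (t j <= rho + j.+1)%N & ((j < ell)%N -> (t j <= rho)%N)].
Proof.
move=> jN; have fl : flat j (rho + j.+1).
  apply/andP; split; first lia.
  by rewrite !g_top //; lia.
have [|fl' le] := first_flatP _ fl; first lia.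
split=> // /ell_flat[v vr flv].
by have [|_] := first_flatP _ flv; lia.
Qed.

Lemma first_flat_lt j : (rho + j.+1 < N)%N -> (t j < t j.+1)%N.
Proof.
move=> jN; have [fl le _] := first_flat_bound jN.
have [|fl' _] := flat_pred _ fl; first lia.
have [|_ le'] := first_flatP _ fl'; first lia.
by have /andP[] := fl; lia.
Qed.

Lemma first_flat_gap i j : (i <= j)%N -> (rho + j < N)%N ->
  (t i + (j - i) <= t j)%N.
Proof.
move=> ij jN; elim: j ij jN => [|j IH]; first by rewrite leqn0 => /eqP->; lia.
rewrite leq_eqVlt => /predU1P[->|ij] jN; first by rewrite subnn addn0.
have := first_flat_lt jN; have := IH ij; lia.
Qed.

Lemma first_flat0 : t 0 = 1%N.
Proof.
have [|fl _ _] := @first_flat_bound 0; first lia.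
have [||_ le] := @first_flatP 0 1; [lia | by rewrite /flat subn0 eqxx | ].
have /andP[] := fl; lia.
Qed.

(** Summands inherit flatness, so a summand would be a smaller argument at offset [j]. *)
Lemma first_flat_nsplits j : (j < ell)%N -> ~ splits (t j).
Proof.
move=> jl [x [y [x0 y0 xy E]]].
have [|fl _ /(_ jl) tr] := @first_flat_bound j; first by have := ell_le; lia.
have [flx _] : flat j x /\ flat j y.
  by apply: flat_split; rewrite ?xy ?E //; lia.
have := @first_flat_min j x; rewrite flx; lia.
Qed.

Hypothesis gen_cases : forall v, (0 < v <= rho)%N ->
  (exists2 j, (j < ell)%N & v = t j) \/ splits v.

(* Every flat argument below the next [first_flat] value is a sum of arguments
   at least as flat, hence of copies of [t j] alone. *)
Lemma first_flat_mult j v : (v <= rho + ell)%N -> (rho + j.+1 < N)%N ->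
  (v < t j.+1)%N -> flat j v ->
  exists c, [/\ (0 < c)%N, v = (c * t j)%N & g v = c%:Z * g (t j)].
Proof.
elim/ltn_ind: v => v IH vl jN vt fl.
have v0 : (0 < v)%N by case/andP: fl; lia.
have vN : (v <= N)%N by have := ell_le; lia.
have [[i il Ei]|[x [y [x0 y0 xy E]]]] :
    (exists2 i, (i < ell)%N & v = t i) \/ splits v.
- by have [vr|vr] := leqP v rho; [apply: gen_cases; lia | right; apply: splits_top; lia].
- suff -> : v = t j by exists 1%N; split; rewrite ?mul1n ?mul1r.
  rewrite Ei; congr t; have [ij|ji|//] := ltngtP i j.
    have [|_ le] := first_flatP _ fl => //.
    by have := @first_flat_gap i j; lia.
  by have := @first_flat_gap j.+1 i; have := ell_le; lia.
- have [flx fly] : flat j x /\ flat j y.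
    by apply: flat_split; rewrite ?xy ?E //; lia.
  have [|||c [c0 Ec Gc]] := IH x _ _ jN _ flx; try lia.
  have [|||c' [c'0 Ec' Gc']] := IH y _ _ jN _ fly; try lia.
  exists (c + c')%N; split; [lia|by rewrite mulnDl -Ec -Ec'|].
  by rewrite -E Gc Gc' PoszD mulrDl.
Qed.

(** The predecessor of [t j.+1] is flat at offset [j] and has the same value, so it is a multiple of
    [t j]. For [ell <= j] both arguments are on the top plateau and the factor is 1. *)
Lemma first_flat_step j : (rho + j.+1 < N)%N ->
  exists c, [/\ (0 < c)%N, t j.+1 = (c * t j).+1 & g (t j.+1) = c%:Z * g (t j)].
Proof.
move=> jN; have [lj|jl] := leqP ell j.
  exists 1%N; rewrite !first_flat_eq; try lia.
  by split=> //; [lia | rewrite !g_top; lia].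
have [fl le _] := first_flat_bound jN.
have [|fl' <-] := flat_pred _ fl; first lia.
have /andP[lt _] := fl.
have [||c [c0 Ec Gc]] := first_flat_mult _ jN _ fl'; try lia.
exists c; split=> //; lia.
Qed.

End Plateaus.

(** * Apery coordinates *)

(* [f z] stands for the least [t] with [z * alpha + t * e] in the semigroup,
   where [e = rho + sigma + n] is the multiplicity; the pseudo-Frobenius numbers
   correspond to the arguments strictly between [rho] and [rho + n]. *)
Record kunz_function (f : int -> int) (alpha : int) (n rho sigma : nat)
    (F : int) : Prop := KunzFunction {
  kunz_n_ge3 : (3 <= n)%N;
  kunz_small : (rho + sigma + 2 <= n)%N;
  kunz0 : f 0 = 0;
  kunz_sub : forall x y : int, f (x + y) <= f x + f y;
  kunz_per : forall x k : int, f (x + k * (rho + sigma + n)%:Z) = f x - k * alpha;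
  kunz_top : forall u : int, rho%:Z < u < (rho + n)%:Z -> f u = F;
  kunz_max : forall u z : int, rho%:Z < u < (rho + n)%:Z ->
    ~ (exists k : int, z = k * (rho + sigma + n)%:Z) -> f (u + z) < f u + f z;
  kunz_partner : forall z : int,
    exists2 u : int, rho%:Z < u < (rho + n)%:Z & f z + f (u - z) = F
}.

(** Reflection exchanges the two sides of 0; one period brings [- u] back to the top interval and
    changes the top value by [alpha]. *)
Lemma kunz_opp f alpha n rho sigma F :
  kunz_function f alpha n rho sigma F ->
  kunz_function (fun z => f (- z)) (- alpha) n sigma rho (F + alpha).
Proof.
case=> n3 sm f0 fs fp ft fm fpa.
have fp1 x : f (x - (rho + sigma + n)%:Z) = f x + alpha.
  by have := fp x (- 1); rewrite mulN1r mulN1r opprK.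
have fp2 x : f x = f (x + (rho + sigma + n)%:Z) + alpha.
  by have := fp x 1; rewrite !mul1r => ->; rewrite subrK.
have e1 x : - x + (rho + sigma + n)%:Z = (rho + sigma + n)%:Z - x by rewrite addrC.
split=> //=.
- lia.
- by move=> x y; rewrite opprD.
- move=> x k; rewrite opprD -mulNr (addnC sigma) fp; ring.
- by move=> u Hu; rewrite fp2 e1 ft //; lia.
- move=> u z Hu Hz; rewrite opprD fp2 (fp2 (- u)) e1.
  have -> : - u - z + (rho + sigma + n)%:Z = (rho + sigma + n)%:Z - u - z by ring.
  suff : ~ (exists k : int, - z = k * (rho + sigma + n)%:Z).
    by move=> h; have := fm ((rho + sigma + n)%:Z - u) (- z) _ h; lia.
  by move=> [k E]; apply: Hz; exists (- k); rewrite (addnC sigma) mulNr -E opprK.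
- move=> z; have [u Hu E] := fpa (- z); exists ((rho + sigma + n)%:Z - u); first lia.
  rewrite -E.
  have -> : - ((rho + sigma + n)%:Z - u - z) = u + z - (rho + sigma + n)%:Z by ring.
  by rewrite fp1 opprK addrA.
Qed.

Section Kunz.

Variables (f : int -> int) (alpha : int) (n rho sigma : nat) (F : int).
Hypothesis Kf : kunz_function f alpha n rho sigma F.

Local Notation e := (rho + sigma + n)%N.

Definition kunz_split (z : int) : Prop :=
  exists x y : int,
    [/\ ~ (exists k : int, x = k * e%:Z), ~ (exists k : int, y = k * e%:Z),
        x + y = z & f x + f y = f z].

Lemma nmul_small x : 0 < `|x| < e%:Z -> ~ (exists k : int, x = k * e%:Z).
Proof.
move=> H [k Ek]; rewrite Ek normrM in H.
have [k0|k1] : `|k| = 0 \/ 1 <= `|k| by lia.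
  by rewrite k0 mul0r in H; lia.
by nia.
Qed.

(** Both [rho + 1] and [rho + 1 + v] are top arguments, so [kunz_max] reads [F < F + f v]. *)
Lemma kunz_gt0 v : 0 < v <= n%:Z - 2 -> 0 < f v.
Proof.
have sm := kunz_small Kf; move=> Hv.
have /(kunz_max Kf (u := rho%:Z + 1)) : ~ (exists k : int, v = k * e%:Z).
  by apply: nmul_small; lia.
move=> h; have := h _; rewrite (kunz_top Kf (u := rho%:Z + 1)); last lia.
by rewrite (kunz_top Kf (u := rho%:Z + 1 + v)); lia.
Qed.

(* By [kunz_max], no summand of an exact splitting is congruent to an argument
   strictly between [rho] and [rho + n]. *)
Lemma kunz_reduce (x y : int) :
  ~ (exists k : int, x = k * e%:Z) -> ~ (exists k : int, y = k * e%:Z) ->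
  f x + f y = f (x + y) ->
  exists k x0, [/\ x = x0 + k * e%:Z, - sigma%:Z <= x0 <= rho%:Z, x0 != 0 &
                  f x = f x0 - k * alpha].
Proof.
move=> nx ny E; exists (divz (x + sigma%:Z) e%:Z), (modz (x + sigma%:Z) e%:Z - sigma%:Z).
have n0 := kunz_n_ge3 Kf.
have Ex := divz_eq (x + sigma%:Z) e%:Z; have e0 : e%:Z != 0 by lia.
have := modz_ge0 (x + sigma%:Z) e0; have := @ltz_pmod (x + sigma%:Z) e%:Z.
set k := divz _ _ in Ex *; set r := modz _ _ in Ex * => lt ge.
have Ex' : x = r - sigma%:Z + k * e%:Z by lia.
have fx : f x = f (r - sigma%:Z) - k * alpha by rewrite {1}Ex' (kunz_per Kf).
split=> //; last first.
  by apply/eqP => r0; apply: nx; exists k; rewrite Ex' r0 add0r.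
suff : ~ (rho%:Z < r - sigma%:Z) by lia.
move=> lr; have := kunz_max Kf (u := r - sigma%:Z) (z := y) _ ny.
have -> : r - sigma%:Z + y = x + y + (- k) * e%:Z by rewrite Ex'; ring.
rewrite (kunz_per Kf); lia.
Qed.

(** Once reduced to [[- sigma, rho]], two summands reach a top argument only if both are positive,
    or, up to one period, both negative. *)
Lemma kunz_split_top z : rho%:Z < z < (rho + n)%:Z -> kunz_split z ->
  (exists a b : nat, [/\ (0 < a <= rho)%N, (0 < b <= rho)%N, z = (a + b)%:Z &
     f a%:Z + f b%:Z = F]) \/
  (exists a b : nat, [/\ (0 < a <= sigma)%N, (0 < b <= sigma)%N,
     z = e%:Z - (a + b)%:Z & f (- a%:Z) + f (- b%:Z) = F + alpha]).
Proof.
move=> Hz [x [y [nx ny xy E]]].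
have sm := kunz_small Kf.
have [|k [x0 [Ex rx x00 fx]]] := kunz_reduce nx ny; first by rewrite xy.
have [|k' [y0 [Ey ry y00 fy]]] := kunz_reduce ny nx; first by rewrite addrC E addrC xy.
have Ez : z = x0 + y0 + (k + k') * e%:Z by rewrite -xy Ex Ey; ring.
have Ef : f x0 + f y0 - (k + k') * alpha = F.
  by rewrite -(kunz_top Kf Hz) -E fx fy; ring.
have [kk|[kk|kk]] : k + k' = 0 \/ k + k' = 1 \/ (k + k' < 0) \/ (1 < k + k') by lia.
- left; rewrite kk !mul0r in Ez Ef; have := Ez => Ez'.
  have x1 : 0 < x0 by lia. have y1 : 0 < y0 by lia.
  exists `|x0|%N, `|y0|%N; rewrite !gez0_abs; try lia.
  by split; lia.
- right; rewrite kk !mul1r in Ez Ef.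
  have x1 : x0 < 0 by lia. have y1 : y0 < 0 by lia.
  exists `|x0|%N, `|y0|%N; rewrite !ltz0_abs // !opprK.
  by split; lia.
- exfalso; nia.
Qed.

Lemma kunz_partner_le z : 0 < z <= rho%:Z ->
  exists w, [/\ 0 < w <= rho%:Z, rho%:Z < z + w & f z + f w = F].
Proof.
move=> Hz; have [u Hu E] := kunz_partner Kf z.
have sm := kunz_small Kf.
exists (u - z); split=> //; last lia.
have fz : 0 < f z by apply: kunz_gt0; lia.
suff : ~ (rho%:Z < u - z) by lia.
by move=> lt; move: E; rewrite (kunz_top Kf (u := u - z)); lia.
Qed.

Lemma kunz_split_low z : 0 < z <= rho%:Z -> kunz_split z ->
  exists a b : nat, [/\ (0 < a)%N, (0 < b)%N, z = (a + b)%:Z &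
     f a%:Z + f b%:Z = f z].
Proof.
move=> Hz [x [y [nx ny xy E]]].
have sm := kunz_small Kf.
have [|k [x0 [Ex rx x00 fx]]] := kunz_reduce nx ny; first by rewrite xy.
have [|k' [y0 [Ey ry y00 fy]]] := kunz_reduce ny nx; first by rewrite addrC E addrC xy.
have Ez : z = x0 + y0 + (k + k') * e%:Z by rewrite -xy Ex Ey; ring.
have kk : k + k' = 0 by nia.
have Ef : f x0 + f y0 = f z.
  transitivity (f x0 + f y0 - (k + k') * alpha); first by rewrite kk; ring.
  by rewrite -E fx fy; ring.
rewrite kk mul0r addr0 in Ez.
(* Opposite signs are impossible: for a partner [w] of [z], both [z + w] and [a + w = z + w - b] are
   top arguments, so [kunz_max] gives [0 < f b]; then [f a + f w < F], against subadditivity. *)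
have mixed (a b : int) : 0 < a -> b < 0 -> - sigma%:Z <= b -> a <= rho%:Z -> a + b = z ->
    f a + f b = f z -> False.
  move=> a0 b0 sb ar ab Eab; have [w [Hw zw Ew]] := kunz_partner_le Hz.
  have := kunz_sub Kf a w; rewrite (kunz_top Kf (u := a + w)); last lia.
  have /(kunz_max Kf (u := z + w - b)) : ~ (exists k : int, b = k * e%:Z).
    by apply: nmul_small; lia.
  rewrite subrK (kunz_top Kf (u := z + w)); last lia.
  by rewrite (kunz_top Kf (u := z + w - b)); lia.
have [x1|x1] : 0 < x0 \/ x0 < 0 by lia.
  have [y1|y1] : 0 < y0 \/ y0 < 0 by lia.
    by exists `|x0|%N, `|y0|%N; rewrite !gez0_abs; try lia; split; lia.
  by case: (mixed x0 y0); lia.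
by case: (mixed y0 x0); lia.
Qed.

End Kunz.

Lemma kunz_plateau f alpha n rho sigma F :
  kunz_function f alpha n rho sigma F ->
  plateau_function (fun v : nat => f v%:Z) rho (rho + n - 1) F.
Proof.
move=> Kf; have n3 := kunz_n_ge3 Kf; have sm := kunz_small Kf.
have gt0 v : (0 < v <= rho)%N -> 0 < f v%:Z.
  by move=> Hv; apply: (kunz_gt0 Kf); lia.
have partner v : (0 < v <= rho)%N ->
  exists w, [/\ (0 < w <= rho)%N, (rho < v + w)%N & f v%:Z + f w%:Z = F].
  move=> Hv; have [|w [w0 vw E]] := kunz_partner_le Kf (z := v%:Z); first lia.
  by exists `|w|%N; rewrite gez0_abs; [split; lia | lia].
split=> //.
- lia.
- exact: kunz0 Kf.
- case: (posnP rho) => [r0|r0].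
    have -> : F = f 1 by rewrite (kunz_top Kf) //; lia.
    by apply: (kunz_gt0 Kf); lia.
  have [|w [Hw _ <-]] := partner 1%N; first lia.
  by have := gt0 1%N; have := gt0 w; lia.
- by move=> v w _; rewrite PoszD; exact: kunz_sub Kf _ _.
- by move=> v Hv; apply: (kunz_top Kf); lia.
Qed.

Lemma kunz_split_opp f alpha n rho sigma F (z : int) :
  kunz_function f alpha n rho sigma F -> kunz_split f n rho sigma z ->
  kunz_split (fun z => f (- z)) n sigma rho ((rho + sigma + n)%:Z - z).
Proof.
move=> Kf [x [y [nx ny xy E]]].
have fp1 w : f (w - (rho + sigma + n)%:Z) = f w + alpha.
  by have := kunz_per Kf w (- 1); rewrite mulN1r mulN1r opprK.
exists (- x), ((rho + sigma + n)%:Z - y); rewrite (addnC sigma); split.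
- by case=> k Ek; apply: nx; exists (- k); rewrite mulNr -Ek opprK.
- by case=> k Ek; apply: ny; exists (1 - k); rewrite mulrBl mul1r -Ek; ring.
- by rewrite -xy; ring.
- by rewrite opprK !opprB !fp1 -E addrA.
Qed.

(** Left arguments are listed upwards by [p], right ones downwards by [q], and the lists meet in
    column [K]. That these [n - 1] arguments exhaust the nonsplitting ones is left as a premise,
    since it comes from counting the generators of the semigroup. *)
Lemma kunz_chain f alpha n rho sigma F :
  kunz_function f alpha n rho sigma F ->
  exists (K : nat) (p q : nat -> nat),
  [/\ (0 < K < n)%N, p 1%N = 1%N, q n.-1 = 1%N & (p K + q K)%N = (rho + sigma + n)%N] /\
  [/\ forall i j, (0 < i < j)%N -> (j <= K)%N -> (p i < p j)%N,
      forall i j, (K <= i < j)%N -> (j < n)%N -> (q j < q i)%N,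
      forall i, (0 < i <= K)%N -> ~ kunz_split f n rho sigma (p i)%:Z,
      forall i, (K <= i < n)%N ->
        ~ kunz_split f n rho sigma ((rho + sigma + n)%:Z - (q i)%:Z)
    & (forall z : nat, (0 < z < rho + sigma + n)%N ->
         [\/ kunz_split f n rho sigma z%:Z,
            exists2 i, (0 < i <= K)%N & z = p i
          | exists2 i, (K <= i < n)%N & z = (rho + sigma + n - q i)%N]) ->
      (forall i, (0 < i < K)%N -> exists c, [/\ (0 < c)%N, p i.+1 = (c * p i).+1 &
          f (p i.+1)%:Z = c%:Z * f (p i)%:Z]) /\
      (forall i, (K <= i < n.-1)%N -> exists c, [/\ (0 < c)%N, q i = (c * q i.+1).+1 &
          f (- (q i)%:Z) = c%:Z * f (- (q i.+1)%:Z)])].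
Proof.
move=> Kf; have Kf' := kunz_opp Kf; have n3 := kunz_n_ge3 Kf; have sm := kunz_small Kf.
have P := kunz_plateau Kf; have P' := kunz_plateau Kf'.
set g := (fun v : nat => _) in P; set g' := (fun v : nat => _) in P'.
pose t := first_flat g (rho + n - 1); pose t' := first_flat g' (sigma + n - 1).
pose l := plateau_length g rho; pose l' := plateau_length g' sigma.
have ll : (l <= rho)%N := ell_le P; have ll' : (l' <= sigma)%N := ell_le P'.
have tl i : (l <= i)%N -> (i < n.-1)%N -> t i = (rho + i.+1)%N.
  by move=> li il; apply: (first_flat_eq P) => //; lia.
have tl' i : (l' <= i)%N -> (i < n.-1)%N -> t' i = (sigma + i.+1)%N.
  by move=> li il; apply: (first_flat_eq P') => //; lia.
have tle i : (i < l)%N -> (0 < t i <= rho)%N.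
  move=> li; have [|fl _ /(_ li) le] := first_flat_bound P (j := i); first lia.
  by move: fl le; rewrite /flat -/(t i); lia.
have tle' i : (i < l')%N -> (0 < t' i <= sigma)%N.
  move=> li; have [|fl _ /(_ li) le] := first_flat_bound P' (j := i); first lia.
  by move: fl le; rewrite /flat -/(t' i); lia.
(* These top arguments are out of reach of sums from either side, by [top_split_le]. *)
have mid j : (l <= j)%N -> (l' <= n - 2 - j)%N -> (j < n.-1)%N ->
    ~ kunz_split f n rho sigma (rho + j.+1)%:Z.
  move=> lj lj' jn /(kunz_split_top Kf) [|[a [b [Ha Hb Eab E]]]|[a [b [Ha Hb Eab E]]]].
  - lia.
  - by have := top_split_le P Ha Hb _ E; rewrite -/l; lia.
  - by have := top_split_le P' Ha Hb _ E; rewrite -/l'; lia.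
have low j : (j < l)%N -> ~ kunz_split f n rho sigma (t j)%:Z.
  move=> jl /(kunz_split_low Kf) [|a [b [a0 b0 Eab E]]]; first by have := tle _ jl; lia.
  by apply: (first_flat_nsplits P jl); exists a, b; split=> //; case: Eab.
have high j : (j < l')%N ->
    ~ kunz_split f n rho sigma ((rho + sigma + n)%:Z - (t' j)%:Z).
  move=> jl /(kunz_split_opp Kf); rewrite opprB addrC subrK.
  case/(kunz_split_low Kf') => [|a [b [a0 b0 Eab E]]]; first by have := tle' _ jl; lia.
  by apply: (first_flat_nsplits P' jl); exists a, b; split=> //; case: Eab.
(* Column [l + 1] is the first one past the left arguments up to [rho]. It carries [rho + l + 1],
   which is [sigma + n - 1 - l] seen from the right. *)
exists l.+1, (fun i => t i.-1), (fun i => t' (n.-1 - i)%N); split.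
  split=> /=; first lia.
  - exact: first_flat0 P.
  - by rewrite subnn; exact: first_flat0 P'.
  - by rewrite tl ?tl'; lia.
have pmono i j : (0 < i < j)%N -> (j <= l.+1)%N -> (t i.-1 < t j.-1)%N.
  move=> ij jl; have := first_flat_gap P (i := i.-1) (j := j.-1).
  by rewrite -/(t _) -/(t _); lia.
have qmono i j : (l < i < j)%N -> (j < n)%N -> (t' (n.-1 - j) < t' (n.-1 - i))%N.
  move=> ij jl; have := first_flat_gap P' (i := n.-1 - j) (j := n.-1 - i).
  by rewrite -/(t' _) -/(t' _); lia.
split=> //.
- move=> i Hi; have [il|il] := ltnP i.-1 l; first exact: low.
  by rewrite tl; try lia; apply: mid; lia.
- move=> i Hi; have [il|il] := ltnP (n.-1 - i) l'; first exact: high.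
  rewrite tl'; try lia.
  have -> : (rho + sigma + n)%:Z - (sigma + (n.-1 - i).+1)%:Z = (rho + i.-1.+1)%:Z by lia.
  by apply: mid; lia.
move=> gens.
have qle i : (l < i < n)%N -> (t' (n.-1 - i)%N <= sigma + n - l.+1)%N.
  move=> Hi; have [|_ le _] := first_flat_bound P' (j := n.-1 - i); first lia.
  by move: le; rewrite -/(t' _); lia.
have ple i : (0 < i <= l.+1)%N -> (t i.-1 <= rho + l.+1)%N.
  move=> Hi; have [|_ le _] := first_flat_bound P (j := i.-1); first lia.
  by move: le; rewrite -/(t _); lia.
split.
- have cases v : (0 < v <= rho)%N -> (exists2 j, (j < l)%N & v = t j) \/ splits g v.
    move=> Hv; have [|sp|[i Hi Ei]|[i Hi Ei]] := gens v; first lia.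
    + case/(kunz_split_low Kf): sp => [|a [b [a0 b0 Eab E]]]; first lia.
      by right; exists a, b; split=> //; lia.
    + left; exists i.-1 => //; have [|il] := ltnP i.-1 l; first by [].
      by move: Ei; rewrite tl; lia.
    + by have := qle i; lia.
  move=> i Hi; have [|c Hc] := first_flat_step P cases (j := i.-1); first lia.
  by exists c; rewrite prednK in Hc; [exact: Hc | lia].
- have cases v : (0 < v <= sigma)%N -> (exists2 j, (j < l')%N & v = t' j) \/ splits g' v.
    move=> Hv; have [|sp|[i Hi Ei]|[i Hi Ei]] := gens (rho + sigma + n - v)%N; first lia.
    + have := kunz_split_opp Kf sp.
      have -> : (rho + sigma + n)%:Z - (rho + sigma + n - v)%N%:Z = v%:Z by lia.
      case/(kunz_split_low Kf') => [|a [b [a0 b0 Eab E]]]; first lia.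
      by right; exists a, b; split=> //; lia.
    + by have := ple i; lia.
    + left; exists (n.-1 - i)%N; last by have := qle i; lia.
      by rewrite ltnNge; apply/negP => il; move: Ei; rewrite tl'; lia.
  move=> i Hi; have [|c Hc] := first_flat_step P' cases (j := (n.-1 - i.+1)%N); first lia.
  by exists c; have -> : (n.-1 - i = (n.-1 - i.+1).+1)%N by lia.
Qed.

(** * Numerical semigroups *)

(** Membership over the integers avoids truncated subtraction. *)
Definition int_mem (H : {pred nat}) (x : int) : bool :=
  if x is Posz k then k \in H else false.

Definition int_pseudo_frobenius (H : {pred nat}) (x : int) : Prop :=
  ~~ int_mem H x /\ forall y, int_mem H y -> 0 < y -> int_mem H (x + y).

Section Semigroup.

Variables (H : {pred nat}) (n : nat) (a : 'I_n -> nat) (i0 : 'I_n).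
Hypothesis Hsg : numerical_semigroup H.
Hypothesis Hgen : minimally_generated_by H a.

Local Notation e := (a i0).
Local Notation inH := (int_mem H).

Lemma mem_genP h : h \in H <-> exists c : 'I_n -> nat, h = (\sum_i c i * a i)%N.
Proof.
case: Hgen => /(_ h) [h1 h2] _; split=> [/h1[c ->]|[c Ec]].
  by exists c; apply: eq_bigl => i; rewrite inE.
by apply: h2; exists c; rewrite Ec; apply: eq_bigl => i; rewrite inE.
Qed.

Lemma sum_delta (c : nat) (j : 'I_n) (b : 'I_n -> nat) :
  (\sum_i (i == j) * c * b i = c * b j)%N.
Proof.
rewrite (bigD1 j) //= eqxx mul1n big1 ?addn0 // => i /negbTE->.
by rewrite !mul0n.
Qed.

Lemma gen_mem i : a i \in H.
Proof.
by apply/mem_genP; exists (fun k => (k == i) * 1)%N; rewrite sum_delta mul1n.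
Qed.

Lemma gen_irredundant j (c : 'I_n -> nat) :
  c j = 0%N -> a j <> (\sum_i c i * a i)%N.
Proof.
move=> cj Ej; case: Hgen => _ /(_ (setT :\ j)); apply.
  by apply/properP; split; [apply: subsetT | exists j; rewrite ?inE ?eqxx].
move=> h; split.
  case/mem_genP => d Ed; exists (fun i => d i + d j * c i)%N.
  rewrite Ed (bigD1 j) //= Ej (bigD1 j (P := xpredT)) //= cj mul0n add0n.
  rewrite addnC big_distrr -big_split /=; apply: eq_big => [i|i _].
    by rewrite !inE andbT.
  by rewrite mulnDl mulnA.
case=> d Ed; apply/mem_genP; exists (fun i => if i == j then 0 else d i)%N.
rewrite Ed [RHS](bigD1 j) //= eqxx mul0n add0n; apply: eq_big => [i|i].
  by rewrite !inE andbT.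
by rewrite !inE andbT => /negbTE->.
Qed.

Lemma gen_gt0 i : (0 < a i)%N.
Proof.
rewrite lt0n; apply/eqP => a0; apply: (@gen_irredundant i (fun=> 0%N)) => //.
by rewrite big1.
Qed.

(** By irredundancy [a j] occurs in the expansion of [x] or of [y]; that summand is already at least
    [a j], so the other vanishes. *)
Lemma gen_irreducible j x y :
  x \in H -> y \in H -> a j = (x + y)%N -> x = 0%N \/ y = 0%N.
Proof.
move=> /mem_genP[c Ec] /mem_genP[d Ed] E.
have Es : a j = (\sum_i (c i + d i) * a i)%N.
  by rewrite E Ec Ed -big_split; apply: eq_bigr => i _; rewrite mulnDl.
have [/gen_irredundant/(_ Es) //|cd] : (c j + d j = 0 \/ 0 < c j + d j)%N by lia.
have a0 := gen_gt0 j.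
have Ec' : x = (c j * a j + \sum_(i | i != j) c i * a i)%N by rewrite Ec (bigD1 j).
have Ed' : y = (d j * a j + \sum_(i | i != j) d i * a i)%N by rewrite Ed (bigD1 j).
move: Ec' Ed'; set u := (\sum_(i | _) _)%N; set v := (\sum_(i | _) _)%N => Ec' Ed'.
have [c0|c0] := posnP (c j); [left | right]; nia.
Qed.

Lemma gen_inj : injective a.
Proof.
move=> i j E; apply/eqP; apply: contraT => ij.
case: (@gen_irredundant i (fun k => (k == j) * 1)%N); first by rewrite (negbTE ij).
by rewrite sum_delta mul1n.
Qed.

Lemma sum_mem (c : 'I_n -> nat) : (\sum_i c i * a i)%N \in H.
Proof. by apply/mem_genP; exists c. Qed.

Lemma int_mem_ge0 x : inH x -> 0 <= x.
Proof. by case: x. Qed.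

Lemma int_mem0 : inH 0.
Proof. by case: Hsg. Qed.

Lemma int_memD x y : inH x -> inH y -> inH (x + y).
Proof. by case: Hsg => _ h _; case: x y => [x|x] [y|y] //=; exact: h. Qed.

Lemma int_memP x : inH x -> exists2 k : nat, k \in H & x = k%:Z.
Proof. by case: x => // k; exists k. Qed.

Lemma int_mem_mul (k : nat) x : inH x -> inH (k%:Z * x).
Proof.
move=> Hx; elim: k => [|k IH]; first by rewrite mul0r int_mem0.
by rewrite -addn1 PoszD mulrDl mul1r int_memD.
Qed.

Lemma int_mem_mulz (k : int) x : 0 <= k -> inH x -> inH (k * x).
Proof. by case: k => // k _; exact: int_mem_mul. Qed.

Lemma int_mem_gen i : inH (a i)%:Z.
Proof. exact: gen_mem. Qed.

Lemma int_mem_large : exists N : nat, forall x : int, N%:Z <= x -> inH x.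
Proof. by case: Hsg => _ _ [N HN]; exists N; case=> // x; exact: HN. Qed.

Lemma int_mem_threshold x :
  exists t : int, forall u : int, inH (x + u * e%:Z) <-> t <= u.
Proof.
have [N HN] := int_mem_large; have e0 := gen_gt0 i0.
have up u v : u <= v -> inH (x + u * e%:Z) -> inH (x + v * e%:Z).
  move=> uv Hu; have -> : x + v * e%:Z = x + u * e%:Z + (v - u) * e%:Z by ring.
  by apply/int_memD/int_mem_mulz/int_mem_gen => //; lia.
(* The shift makes all admissible multipliers natural numbers, so that [ex_minn] applies. *)
pose P m := inH (x + (m%:Z - `|x| - 1) * e%:Z).
have exP : exists m, P m.
  by exists (N + `|x|.*2 + 1)%N; apply: HN; nia.
case: (ex_minnP exP) => m Pm minm; exists (m%:Z - `|x| - 1) => u; split=> [Hu|].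
  have hu : - `|x| - 1 <= u by have := int_mem_ge0 Hu; nia.
  have := minm (absz (u + `|x| + 1)); rewrite /P gez0_abs; last lia.
  have -> : u + `|x| + 1 - `|x| - 1 = u by ring.
  by move/(_ Hu); lia.
by move=> /up; apply.
Qed.

(** Add positive elements of [H] as long as the result stays outside [H]. This ends, as all integers
    from [N] on are in [H], and it can only end at a pseudo-Frobenius number. *)
Lemma pseudo_frobenius_above x : ~~ inH x ->
  exists2 p, int_pseudo_frobenius H p & inH (p - x).
Proof.
have [N HN] := int_mem_large.
have [k] := ubnP (absz (N%:Z - x)); elim: k x => // k IH x lek nx.
have xN : x < N%:Z by rewrite ltNge; apply: contra nx; exact: HN.
case: (excluded_middle_informative (int_pseudo_frobenius H x)) => [px|npx].
  by exists x => //; rewrite subrr int_mem0.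
have [y [Hy y0 nxy]] : exists y, [/\ inH y, 0 < y & ~~ inH (x + y)].
  apply: NNPP => nex; apply: npx; split=> // y Hy y0.
  by apply: contraT => nxy; case: nex; exists y.
have xyN : x + y < N%:Z by rewrite ltNge; apply: contra nxy; exact: HN.
have [|p pf Hp] := IH (x + y) _ nxy; first lia.
exists p => //; have -> : p - x = p - (x + y) + y by ring.
by apply: int_memD.
Qed.

Hypothesis Hleast : is_least_nonzero H (a i0).
Hypothesis n_gt1 : (1 < n)%N.

(** If [x < 0], then [x + e] is an element of [H] below [e], so [x = - e]; now [a j - e] is in [H]
    for another generator [a j], against irreducibility. *)
Lemma int_pseudo_frobenius_ge0 x : int_pseudo_frobenius H x -> 0 <= x.
Proof.
case=> nx px; rewrite leNgt; apply/negP => xlt0.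
have e0 := gen_gt0 i0; have [_ _ minH] := Hleast.
have xe : x = - e%:Z.
  have [|k kH Ek] := int_memP (px e%:Z (int_mem_gen i0) _); first lia.
  by have := minH k kH; lia.
have [j ji] : exists j : 'I_n, j != i0.
  have [i00|i00] := eqVneq (val i0) 0%N.
    by exists (Ordinal n_gt1); rewrite -val_eqE /= i00.
  by exists (Ordinal (ltnW n_gt1)); rewrite -val_eqE eq_sym.
have a0 := gen_gt0 j.
have [|k kH Ek] := int_memP (px (a j)%:Z (int_mem_gen j) _); first lia.
have [] := @gen_irreducible j e k (gen_mem i0) kH; try lia.
by move=> k0; case/eqP: ji; apply: gen_inj; lia.
Qed.

Lemma int_pseudo_frobeniusE x :
  int_pseudo_frobenius H x <-> exists2 p, pseudo_frobenius H p & x = p%:Z.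
Proof.
split=> [pf|[p [np pp] ->]].
  case: x pf (int_pseudo_frobenius_ge0 pf) => // p [np pp] _; exists p => //.
  by split=> // h Hh h0; apply: (pp h%:Z).
by split=> // -[h|//] Hh h0; exact: pp.
Qed.

End Semigroup.

(** * Arithmetic pseudo-Frobenius numbers *)

Lemma int_residue (x : int) (e : nat) (lo : int) : (0 < e)%N ->
  exists k r : int, x = r + k * e%:Z /\ lo <= r < lo + e%:Z.
Proof.
move=> e0; exists (divz (x - lo) e%:Z), (lo + modz (x - lo) e%:Z).
have := divz_eq (x - lo) e%:Z; have := @modz_ge0 (x - lo) e%:Z.
have := @ltz_pmod (x - lo) e%:Z; lia.
Qed.

(* The matrix data: [b i] is the degree of the variable [Y_i], and, modulo
   [e = b 0], it is [p i * alpha] left of column [K] and [- q i * alpha] right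
   of it. *)
Record degree_chain (n e : nat) (alpha : int) (b l m : 'I_n -> nat) (K : nat)
    (p q : nat -> nat) : Prop := DegreeChain {
  chain_K : (0 < K < n)%N;
  chain_b0 : forall i : 'I_n, i = 0%N :> nat -> b i = e;
  chain_p1 : p 1%N = 1%N;
  chain_qn : q n.-1 = 1%N;
  chain_pq : (p K + q K)%N = e;
  chain_bp : forall i : 'I_n, (0 < i <= K)%N ->
    exists t : int, (b i)%:Z = (p i)%:Z * alpha + t * e%:Z;
  chain_bq : forall i : 'I_n, (K <= i)%N ->
    exists t : int, (b i)%:Z = - (q i)%:Z * alpha + t * e%:Z;
  chain_l_gt0 : forall i, (0 < l i)%N;
  chain_m_gt0 : forall i, (0 < m i)%N;
  chain_m1 : forall i : 'I_n, (0 < i <= K)%N -> m i = 1%N;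
  chain_l1 : forall i : 'I_n, (K <= i)%N -> l i = 1%N;
  chain_p : forall i : 'I_n, (0 < i < K)%N -> p i.+1 = (l i * p i).+1;
  chain_q : forall i : 'I_n, (K < i)%N -> q i.-1 = (m i * q i).+1;
  chain_rel : forall j,
    (l j * b j)%N%:Z + alpha = (m (ordS j) * b (ordS j))%N%:Z
}.

Section ArithmeticPF.

Variables (H : {pred nat}) (n : nat) (a : 'I_n -> nat) (i0 : 'I_n).
Hypothesis Hsg : numerical_semigroup H.
Hypothesis Hgen : minimally_generated_by H a.
Hypothesis Hleast : is_least_nonzero H (a i0).
Hypothesis n_gt2 : (2 < n)%N.

Local Notation e := (a i0).
Local Notation inH := (int_mem H).

Variables (h alpha : int).
Hypothesis alpha0 : alpha != 0.
Hypothesis e_le : (e + 2 <= 2 * n)%N.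
Hypothesis PFE : forall z, int_pseudo_frobenius H z <->
  exists2 j : nat, (1 <= j <= n - 1)%N & z = h + j%:Z * alpha.

Let n_gt1 : (1 < n)%N := ltnW n_gt2.
Let e_gt0 : (0 < e)%N := gen_gt0 Hgen i0.

Lemma pf_not x : int_pseudo_frobenius H x -> ~~ inH x. Proof. by case. Qed.
Lemma pf_add x y : int_pseudo_frobenius H x -> inH y -> 0 < y -> inH (x + y).
Proof. by case=> _; apply. Qed.

Lemma mem_e (t : int) : 0 <= t -> inH (t * e%:Z).
Proof. by move=> t0; apply: (int_mem_mulz Hsg t0); exact: int_mem_gen Hgen i0. Qed.

Lemma pf_cong x y t : int_pseudo_frobenius H x -> int_pseudo_frobenius H y ->
  y = x + t * e%:Z -> t = 0.
Proof.
move=> px py E; have [t0|[t0|//]] : 0 < t \/ t < 0 \/ t = 0 by lia.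
  have := pf_not py; rewrite E (pf_add px) //; first by apply: mem_e; lia.
  by nia.
have := pf_not px; have -> : x = y + (- t) * e%:Z by rewrite E; ring.
rewrite (pf_add py) //; first by apply: mem_e; lia.
by nia.
Qed.

(** Otherwise two terms of the sequence would be congruent modulo [e], hence equal by [pf_cong]. *)
Lemma alpha_order (j : nat) t : (0 < j < n - 1)%N -> j%:Z * alpha <> t * e%:Z.
Proof.
move=> Hj E.
have p1 : int_pseudo_frobenius H (h + alpha).
  by apply/PFE; exists 1%N; [lia | rewrite mul1r].
have pj : int_pseudo_frobenius H (h + alpha + j%:Z * alpha).
  by apply/PFE; exists j.+1; [lia | rewrite intS; ring].
have t0 := pf_cong p1 pj (congr1 (fun w => h + alpha + w) E).
move: E; rewrite t0 mul0r => /eqP; rewrite mulf_eq0 (negbTE alpha0) orbF; lia.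
Qed.

(** Since [e / g] times [alpha] is a multiple of [e], the quotient [e / g] is at least [n - 1]; as
    [e <= 2 (n - 1)], this leaves [g <= 2]. *)
Lemma alpha_coprime_cases : coprime (absz alpha) e \/
  (2 %| alpha)%Z /\ e = (2 * (n - 1))%N.
Proof.
pose g := gcdn (absz alpha) e.
have g0 : (0 < g)%N by rewrite gcdn_gt0 e_gt0 orbT.
have ge : (g %| e)%N := dvdn_gcdr _ _.
have ga : (g%:Z %| alpha)%Z by apply: dvdn_gcdl.
have Ee : e = (e %/ g * g)%N by rewrite divnK.
have Ea : alpha = divz alpha g%:Z * g%:Z by rewrite divzK.
have ord : (n - 1 <= e %/ g)%N.
  rewrite leqNgt; apply/negP => lt; apply: (@alpha_order (e %/ g) (divz alpha g%:Z)).
    by rewrite lt divn_gt0 // dvdn_leq.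
  by rewrite {1}Ea {2}Ee PoszM; ring.
have [g1|[g2|g3]] : g = 1%N \/ g = 2%N \/ (2 < g)%N by lia.
- by left; rewrite /coprime -/g g1.
- right; split; first by rewrite g2 in ga.
  by rewrite g2 in ord Ee; lia.
- by nia.
Qed.

(* If [alpha] were even, the pseudo-Frobenius numbers would fill up a parity
   class modulo [e]: the odd one, since none is divisible by [e]. *)
Lemma alpha_coprime : coprime (absz alpha) e.
Proof.
case: alpha_coprime_cases => // -[a2 Ee].
have e2 : (2 %| e)%N by rewrite Ee dvdn_mulr.
have Ea : alpha = divz alpha 2 * 2 by rewrite divzK.
set al := divz alpha 2 in Ea.
(* A common factor [g] would make [(n - 1) / g] times [alpha] a multiple of [e]. *)
have cop : coprimez al (n - 1)%N%:Z.
  rewrite /coprimez /gcdz /= -/(coprime _ _) /coprime.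
  set g := gcdn _ _; apply/eqP.
  have g0 : (0 < g)%N by rewrite gcdn_gt0; lia.
  have Eg : (n - 1 = (n - 1) %/ g * g)%N by rewrite divnK // dvdn_gcdr.
  have Eg' : al = divz al g%:Z * g%:Z by rewrite divzK //; apply: dvdn_gcdl.
  have : ~ ((n - 1) %/ g < n - 1)%N.
    move=> lt; apply: (@alpha_order ((n - 1) %/ g) (divz al g%:Z)).
      by rewrite lt divn_gt0 // dvdn_leq ?dvdn_gcdr //; lia.
    rewrite Ea {1}Eg' Ee PoszM {2}Eg PoszM; ring.
  by nia.
have [[u v] /= uv] := coprimezP _ _ cop.
(* As [u] inverts [alpha / 2] modulo [n - 1], the sequence meets every class modulo [e] of the
   parity of [h]. *)
have reach w : exists p t, int_pseudo_frobenius H p /\ h + 2 * w = p + t * e%:Z.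
  have [|k [r [Er Hr]]] := @int_residue (w * u) (n - 1) 1; first lia.
  exists (h + r * alpha), (w * v + k * al); split.
    by apply/PFE; exists (absz r); [lia | rewrite gez0_abs //; lia].
  have -> : r = w * u - k * (n - 1)%N%:Z by rewrite Er; ring.
  have Ew : w = w * (u * al + v * (n - 1)%N%:Z) by rewrite uv mulr1.
  by rewrite {1}Ew Ee PoszM Ea; ring.
have hodd : ~~ (2 %| h)%Z.
  apply/negP => h2; have [p [t [pp Ep]]] := reach (- divz h 2).
  have E0 : p = - t * e%:Z.
    by have := divzK h2; lia.
  have p0 := int_pseudo_frobenius_ge0 Hgen Hleast n_gt1 pp.
  by have := pf_not pp; rewrite E0 mem_e //; nia.
(* Let [y] be the Apery element of residue 2. Subtracting it keeps the parity, so [p - y] is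
   congruent to a pseudo-Frobenius number [q]; every possible distance between them contradicts that
   [p] or [q] is a gap. *)
have [t Ht] := int_mem_threshold i0 Hsg Hgen 2.
set y := 2 + t * e%:Z.
have Hy : inH y by apply/Ht.
have nye : ~~ inH (y - e%:Z).
  have -> : y - e%:Z = 2 + (t - 1) * e%:Z by rewrite /y; ring.
  by apply/negP => /Ht; lia.
have y0 : 0 < y.
  have e4 : (4 <= e)%N by lia.
  have := int_mem_ge0 Hy; rewrite /y.
  by have [t0|t0] : 0 <= t \/ t <= - 1; [lia | nia | nia].
have [p pp Hp] := pseudo_frobenius_above Hsg nye.
have [j _ Ej] := (PFE p).1 pp.
have [] := reach (al * j%:Z - t * (n - 1)%N%:Z + (n - 1)%N%:Z - 1) => q [s [pq Eq]].
have Eqs : p - (y - e%:Z) = q + s * e%:Z.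
  rewrite -Eq Ej /y Ee PoszM Ea; ring.
have npy : ~~ inH (p - y).
  apply/negP => Hpy; have := pf_not pp.
  have -> : p = p - y + y by ring.
  by rewrite (int_memD Hsg).
have Epy : p - y = q + (s - 1) * e%:Z.
  have -> : p - y = p - (y - e%:Z) - e%:Z by ring.
  by rewrite Eqs; ring.
have [s1|[s1|s1]] : s = 1 \/ s < 1 \/ 1 < s by lia.
- have := pf_add pq Hy y0; rewrite s1 subrr mul0r addr0 in Epy.
  by rewrite -Epy subrK (negbTE (pf_not pp)).
- have := pf_not pq.
  have -> : q = p - (y - e%:Z) + (- s) * e%:Z by rewrite Eqs; ring.
  by rewrite (int_memD Hsg) //; apply: mem_e; lia.
- by case/negP: npy; rewrite Epy (pf_add pq) //; [apply: mem_e; lia | nia].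
Qed.


Lemma alpha_bezout : exists u v : int, u * alpha + v * e%:Z = 1.
Proof.
have cop : coprimez alpha e%:Z by exact: alpha_coprime.
by have [[u v] /= uv] := coprimezP _ _ cop; exists u, v.
Qed.

Lemma alpha_cancel z t : z * alpha = t * e%:Z -> exists k : int, z = k * e%:Z.
Proof.
move=> E; have [u [v uv]] := alpha_bezout; exists (u * t + z * v).
transitivity (u * (z * alpha) + z * v * e%:Z); last by rewrite E; ring.
by rewrite -{1}[z]mulr1 -uv; ring.
Qed.

Lemma exists_kunz : exists (f : int -> int) (rho sigma : nat) (F : int),
  [/\ kunz_function f alpha n rho sigma F, e = (rho + sigma + n)%N
    & forall z t, inH (z * alpha + t * e%:Z) <-> f z <= t].
Proof.
have [u [v uv]] := alpha_bezout.
have [f fP] : exists f : int -> int,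
    forall z t, inH (z * alpha + t * e%:Z) <-> f z <= t.
  have ex z := int_mem_threshold i0 Hsg Hgen (z * alpha).
  exists (fun z => proj1_sig (constructive_indefinite_description _ (ex z))) => z.
  exact: proj2_sig (constructive_indefinite_description _ (ex z)).
have fmem z : inH (z * alpha + f z * e%:Z) by apply/fP.
have [k [r [Er Hr]]] := int_residue (h * u) 0 e_gt0.
(* Modulo [e], [h] is [rho * alpha]. A pseudo-Frobenius number is a maximal Apery element minus [e],
   whence the [+ 1]. *)
pose F := h * v + k * alpha + 1; pose rho := absz r.
have Ep j : h + j * alpha = (rho%:Z + j) * alpha + (F - 1) * e%:Z.
  rewrite /rho gez0_abs /F; last lia.
  have -> : r = h * u - k * e%:Z by rewrite Er; ring.
  by rewrite -{1}[h]mulr1 -uv; ring.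
have pfT (w : int) : rho%:Z < w < (rho + n)%:Z ->
    int_pseudo_frobenius H (w * alpha + (F - 1) * e%:Z).
  move=> Hw; apply/PFE; exists (absz (w - rho%:Z)); first lia.
  by rewrite Ep gez0_abs; [congr (_ * _ + _); ring | lia].
have fT (w : int) : rho%:Z < w < (rho + n)%:Z -> f w = F.
  move=> /pfT pw; have h1 : f w <= F.
    apply/fP; have -> : w * alpha + F * e%:Z = w * alpha + (F - 1) * e%:Z + e%:Z by ring.
    by apply: pf_add pw _ _; [exact: int_mem_gen Hgen i0 | lia].
  suff : ~ (f w <= F - 1) by lia.
  by move/fP; apply/negP; exact: pf_not.
(* Otherwise [e] would be a top argument, and some pseudo-Frobenius number a multiple of [e]. *)
have rn : (rho + n <= e)%N.
  rewrite leqNgt; apply/negP => lt.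
  have /pfT pe : rho%:Z < e%:Z < (rho + n)%:Z by lia.
  have ge := int_pseudo_frobenius_ge0 Hgen Hleast n_gt1 pe.
  have E0 : e%:Z * alpha + (F - 1) * e%:Z = (alpha + F - 1) * e%:Z by ring.
  by have := pf_not pe; rewrite E0 mem_e //; nia.
have Ee : (rho + (e - rho - n) + n)%N = e by lia.
have sub x y : f (x + y) <= f x + f y.
  apply/fP; have -> : (x + y) * alpha + (f x + f y) * e%:Z =
    x * alpha + f x * e%:Z + (y * alpha + f y * e%:Z) by ring.
  exact: (int_memD Hsg).
exists f, rho, (e - rho - n)%N, F; split=> //.
split; rewrite ?Ee //.
- lia.
- have h1 : f 0 <= 0 by apply/fP; rewrite !mul0r addr0; exact: int_mem0 Hsg.
  have := int_mem_ge0 (fmem 0); rewrite mul0r add0r pmulr_lge0 ?ltz_nat //.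
  by move=> h2; apply/eqP; rewrite eq_le h1.
- move=> x w.
  have E t : (x + w * e%:Z) * alpha + t * e%:Z = x * alpha + (t + w * alpha) * e%:Z.
    by ring.
  have h1 : f x <= f (x + w * e%:Z) + w * alpha by apply/fP; rewrite -E.
  have h2 : f (x + w * e%:Z) <= f x - w * alpha by apply/fP; rewrite E subrK.
  lia.
- move=> w z Hw nz; rewrite (fT w) //.
  suff : f (w + z) <= F - 1 + f z by lia.
  apply/fP; have -> : (w + z) * alpha + (F - 1 + f z) * e%:Z =
    w * alpha + (F - 1) * e%:Z + (z * alpha + f z * e%:Z) by ring.
  apply: pf_add (pfT w Hw) (fmem z) _.
  have : z * alpha + f z * e%:Z != 0.
    apply/eqP => E0; apply: nz; apply: (@alpha_cancel z (- f z)).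
    by rewrite mulNr; apply/eqP; rewrite -addr_eq0 E0.
  have := int_mem_ge0 (fmem z); lia.
- move=> z; have nz : ~~ inH (z * alpha + (f z - 1) * e%:Z).
    by apply/negP => /fP; lia.
  have [p pp Hp] := pseudo_frobenius_above Hsg nz.
  have [j Hj Ej] := (PFE p).1 pp.
  exists (rho%:Z + j%:Z); first lia.
  have : f (rho%:Z + j%:Z - z) <= F - f z.
    apply/fP; move: Hp; rewrite Ej Ep; congr (int_mem H _); ring.
  have := sub z (rho%:Z + j%:Z - z).
  have -> : z + (rho%:Z + j%:Z - z) = rho%:Z + j%:Z by ring.
  rewrite (fT (rho%:Z + j%:Z)); lia.
Qed.


Section GeneratorIndices.

Variables (f : int -> int) (rho sigma : nat) (F : int).
Hypothesis Kf : kunz_function f alpha n rho sigma F.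
Hypothesis Ee : e = (rho + sigma + n)%N.
Hypothesis fP : forall z t, inH (z * alpha + t * e%:Z) <-> f z <= t.

Definition apery (z : int) : int := z * alpha + f z * e%:Z.

Local Notation split := (kunz_split f n rho sigma).

Lemma apery_mem z : inH (apery z).
Proof. by apply/fP. Qed.

Lemma apery_min z t : 0 < t -> ~~ inH (apery z - t * e%:Z).
Proof.
move=> t0; rewrite /apery.
have -> : z * alpha + f z * e%:Z - t * e%:Z = z * alpha + (f z - t) * e%:Z by ring.
by apply/negP => /fP; lia.
Qed.

Lemma apery_cong x y t : apery x = apery y + t * e%:Z -> exists k : int, x = y + k * e%:Z.
Proof.
move=> E; have [|k Ek] := @alpha_cancel (x - y) (f y - f x + t).
  transitivity (apery x - apery y + (f y - f x) * e%:Z); first by rewrite /apery; ring.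
  by rewrite E; ring.
by exists k; rewrite -Ek; ring.
Qed.

Lemma apery_per z k : apery (z + k * e%:Z) = apery z.
Proof. by rewrite /apery Ee (kunz_per Kf); ring. Qed.

(** Remove one generator from an expansion of the Apery element. If something remained, the
    arguments of the generator and of the remainder would split [z]. *)
Lemma not_split_gen z : 0 < z < e%:Z -> ~ split z ->
  exists2 i, i != i0 & (a i)%:Z = apery z.
Proof.
move=> Hz nsp; have [hz Hhz Ez] := int_memP (apery_mem z).
have nz0 : apery z <> 0.
  move=> E0; have [|k Ek] := @alpha_cancel z (- f z).
    by rewrite mulNr; apply/eqP; rewrite -addr_eq0 -E0.
  have [k0|k0] : k <= 0 \/ 1 <= k by lia.
  - by nia.
  - by nia.
have [c Ec] := (mem_genP Hgen hz).1 Hhz.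
have [i ci] : exists i, (0 < c i)%N.
  apply: NNPP => nex; apply: nz0; rewrite Ez Ec big1 // => i _.
  by case: (posnP (c i)) => [->//|ci]; case: nex; exists i.
have Hy : inH (apery z - (a i)%:Z).
  have -> : apery z - (a i)%:Z = (\sum_k (c k - (k == i)) * a k)%N%:Z.
    rewrite Ez Ec (bigD1 i) //= [in RHS](bigD1 i) //= eqxx.
    have -> : (\sum_(k < n | k != i) (c k - (k == i)) * a k =
               \sum_(k < n | k != i) c k * a k)%N.
      by apply: eq_bigr => k /negbTE->; rewrite subn0.
    have [d ->] : exists d, c i = d.+1 by exists (c i).-1; rewrite prednK.
    by rewrite subSS subn0 mulSn -addnA PoszD addrAC subrr add0r.
  exact: sum_mem.
have ii0 : i != i0.
  apply/eqP => Ei; move: Hy; rewrite Ei.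
  have -> : e%:Z = 1 * e%:Z by rewrite mul1r.
  by apply/negP/apery_min.
exists i => //; apply/eqP; apply: contraT => ne; case: nsp.
have [u [v uv]] := alpha_bezout.
(* [x] is the argument of [a i], because [u] inverts [alpha] modulo [e]. *)
pose x := (a i)%:Z * u; pose t := (a i)%:Z * v.
have Ex : (a i)%:Z = x * alpha + t * e%:Z by rewrite -{1}[(a i)%:Z]mulr1 -uv /x /t; ring.
have fx : f x <= t by apply/fP; rewrite -Ex; exact: int_mem_gen Hgen i.
have fzx : f (z - x) <= f z - t.
  apply/fP; move: Hy; rewrite {1}Ex /apery; congr (int_mem H _); ring.
exists x, (z - x); rewrite -Ee; split.
- case=> k Ek; have [w Ew] : exists w : int, (a i)%:Z = w * e%:Z.
    by exists (k * alpha + t); rewrite Ex Ek; ring.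
  have ai := gen_gt0 Hgen i.
  have w1 : 1 <= w by nia.
  have [hw Hw Ehw] := int_memP (mem_e (t := w - 1) ltac:(lia)).
  have [] := gen_irreducible Hgen (gen_mem Hgen i0) Hw (j := i); try lia.
  by move=> h0; case/eqP: ii0; apply: (gen_inj Hgen); lia.
- case=> k Ek; have [w Ew] : exists w : int, apery z - (a i)%:Z = w * e%:Z.
    exists (k * alpha + (f z - t)).
    have -> : apery z = z * alpha + f z * e%:Z by [].
    have -> : z = x + k * e%:Z by rewrite -Ek; ring.
    by rewrite [in LHS]Ex; ring.
  have ge := int_mem_ge0 Hy.
  have w1 : 1 <= w by have : apery z - (a i)%:Z <> 0; [lia | nia].
  have w0 : 0 < w by lia.
  case/negP: (apery_min z w0).
  by rewrite -Ew opprB addrC subrK; exact: int_mem_gen Hgen i.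
- ring.
- by have := kunz_sub Kf x (z - x); have -> : x + (z - x) = z; [ring | lia].
Qed.

End GeneratorIndices.


Lemma exists_degree_chain : i0 = 0%N :> nat ->
  exists (s : 'S_n) (l m : 'I_n -> nat) (K : nat) (p q : nat -> nat),
    degree_chain e alpha (fun i => a (s i)) l m K p q.
Proof.
move=> i00; have [f [rho [sigma [F [Kf Ee fP]]]]] := exists_kunz.
have [K [p [q [[HK p1 q1 pq] [pmono qmono pns qns steps]]]]] := kunz_chain Kf.
rewrite -Ee in pq qns steps.
have p_gt0 i : (0 < i <= K)%N -> (0 < p i)%N.
  move=> Hi; have [->|i1] : i = 1%N \/ (1 < i)%N by lia.
    by rewrite p1.
  by have := pmono 1%N i; lia.
have q_gt0 i : (K <= i < n)%N -> (0 < q i)%N.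
  move=> Hi; have [->|i1] : i = n.-1 \/ (i < n.-1)%N by lia.
    by rewrite q1.
  by have := qmono i n.-1; lia.
have pK i : (0 < i <= K)%N -> (p i <= p K)%N.
  move=> Hi; have [->//|i1] : i = K \/ (i < K)%N by lia.
  by have := pmono i K; lia.
have qK i : (K <= i < n)%N -> (q i <= q K)%N.
  move=> Hi; have [->//|i1] : i = K \/ (K < i)%N by lia.
  by have := qmono K i; lia.
(* Both sides are put on one increasing scale between 0 and [e]. *)
pose c i := if (i <= K)%N then (p i)%:Z else e%:Z - (q i)%:Z.
have qK0 := q_gt0 K; have pK0 := p_gt0 K.
have cmono i j : (0 < i < j)%N -> (j < n)%N -> c i < c j.
  rewrite /c => Hij jn; have := pmono i j; have := qmono i j; have := pK i.
  have := qmono K j.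
  by case: (leqP j K); case: (leqP i K); lia.
have cK i : (K <= i)%N -> c i = e%:Z - (q i)%:Z.
  rewrite /c => Ki; case: (leqP i K) => // iK.
  have -> : i = K by lia.
  lia.
have cR i : (0 < i < n)%N -> 0 < c i < e%:Z.
  move=> Hi; rewrite /c; have := p_gt0 i; have := q_gt0 i; have := pK i.
  by have := qK i; case: (leqP i K); lia.
have cns i : (0 < i < n)%N -> ~ kunz_split f n rho sigma (c i).
  by move=> Hi; rewrite /c; case: (leqP i K) => Ki; [apply: pns | apply: qns]; lia.
have ex (i : 'I_n) : exists k : 'I_n,
    (i = 0%N :> nat -> k = i0) /\ ((0 < i)%N -> k != i0 /\ (a k)%:Z = apery f (c i)).
  case: (posnP i) => [i0'|ip]; first by exists i0; split=> //; lia.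
  have Hi : (0 < i < n)%N by rewrite ip ltn_ord.
  have [k k0 Ek] := not_split_gen Kf Ee fP (cR _ Hi) (cns _ Hi).
  by exists k; split=> //; lia.
have [s0 Hs0] := fin_all_exists ex.
have aper_eq x y : 0 < x < e%:Z -> 0 < y < e%:Z -> apery f x = apery f y -> x = y.
  move=> Hx Hy E; have [|k Ek] := apery_cong (f := f) (t := 0) (x := x) (y := y).
    by rewrite mul0r addr0.
  by have [k0|[k0|k0]] : k = 0 \/ 1 <= k \/ k <= -1; [lia | nia | nia | nia].
have sinj : injective s0.
  have half (i j : 'I_n) : (i < j)%N -> s0 i != s0 j.
    move=> ij; have [hi1 hi2] := Hs0 i; have [hj1 hj2] := Hs0 j.
    have [|nj Ej] := hj2; first lia.
    case: (posnP i) => [/hi1->|/hi2 [ni Ei]]; first by rewrite eq_sym.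
    apply/eqP => Es; have := @aper_eq (c i) (c j); rewrite -Ei -Ej Es => /(_ _ _ erefl).
    have := cmono i j; have := cR i; have := cR j; have := ltn_ord j.
    have : (0 < i)%N by case: (posnP i) => // /hi1 Ei0; rewrite Ei0 eqxx in ni.
    lia.
  move=> i j E; apply/val_inj; have [ij|ji|//] := ltngtP i j.
    by have := half i j ij; rewrite E eqxx.
  by have := half j i ji; rewrite E eqxx.
pose s := perm sinj; have sE i : s i = s0 i by rewrite permE.
(* The arguments [c i] and the multiplicity use up all [n] generators, so every nonsplitting
   argument is some [c i]. *)
have [z|stepp stepq] := steps.
  move=> Hz; have [sp|nsp] := classic (kunz_split f n rho sigma z%:Z).
    by constructor 1.
  have [|k k0 Ek] := not_split_gen Kf Ee fP _ nsp; first lia.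
  pose i := (s^-1)%g k; have Ei : k = s0 i by rewrite -sE permKV.
  have [hi1 hi2] := Hs0 i; rewrite Ei in Ek k0.
  have ip : (0 < i)%N by case: (posnP i) => // /hi1 Ei0; rewrite Ei0 eqxx in k0.
  have [_ Eki] := hi2 ip; have li := ltn_ord i.
  have Ez : z%:Z = c i.
    by apply: aper_eq; [lia | apply: cR; lia | rewrite -Ek -Eki].
  have [iK|iK] := leqP i K.
    by constructor 2; exists (nat_of_ord i); [lia | move: Ez; rewrite /c iK; lia].
  constructor 3; exists (nat_of_ord i); first lia.
  by move: Ez; rewrite cK; have := qK i; lia.
have f1 : 0 < f 1 by apply: (kunz_gt0 Kf); lia.
have f1' : 0 < f (- 1) by apply: (kunz_gt0 (kunz_opp Kf)); lia.
(* [Y_0] has degree [e], so its exponents are the multiples of [e] in the Apery elements of 1 and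
   -1. The others are the factors found in [kunz_chain]. *)
pose l (i : 'I_n) : nat := if nat_of_ord i == 0%N then absz (f 1)
  else if (i < K)%N then ((p i.+1).-1 %/ p i)%N else 1%N.
pose m (i : 'I_n) : nat := if nat_of_ord i == 0%N then absz (f (- 1))
  else if (K < i)%N then ((q i.-1).-1 %/ q i)%N else 1%N.
have lP (i : 'I_n) : (0 < i < K)%N -> [/\ (0 < l i)%N, p i.+1 = (l i * p i).+1 &
    f (p i.+1)%:Z = (l i)%:Z * f (p i)%:Z].
  move=> Hi; have [d [d0 Ed Fd]] := stepp _ Hi; suff -> : l i = d by [].
  rewrite /l ifN; last lia.
  by rewrite ifT ?Ed /= ?mulnK //; [apply: p_gt0|]; lia.
have mP (i : 'I_n) : (K < i)%N -> [/\ (0 < m i)%N, q i.-1 = (m i * q i).+1 &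
    f (- (q i.-1)%:Z) = (m i)%:Z * f (- (q i)%:Z)].
  move=> Hi; have li := ltn_ord i; have [|d [d0]] := stepq i.-1; first lia.
  rewrite prednK => [Ed Fd|]; last lia.
  suff -> : m i = d by [].
  rewrite /m ifN; last lia.
  by rewrite ifT ?Ed /= ?mulnK //; apply: q_gt0; lia.
have l1 (i : 'I_n) : (K <= i)%N -> l i = 1%N.
  by move=> Hi; rewrite /l ifN ?ifN; lia.
have m1 (i : 'I_n) : (0 < i <= K)%N -> m i = 1%N.
  by move=> Hi; rewrite /m ifN ?ifN; lia.
have b0 (i : 'I_n) : i = 0%N :> nat -> a (s i) = e.
  by move=> Hi; have [h1 _] := Hs0 i; rewrite sE h1.
have bp (i : 'I_n) : (0 < i <= K)%N ->
    (a (s i))%:Z = (p i)%:Z * alpha + f (p i)%:Z * e%:Z.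
  move=> Hi; have [_ /(_ ltac:(lia)) [_ E]] := Hs0 i; rewrite sE E /apery /c.
  by case: leqP; lia.
have bq (i : 'I_n) : (K <= i)%N ->
    (a (s i))%:Z = - (q i)%:Z * alpha + f (- (q i)%:Z) * e%:Z.
  move=> Hi; have [_ /(_ ltac:(lia)) [_ E]] := Hs0 i; rewrite sE E cK //.
  have -> : e%:Z - (q i)%:Z = - (q i)%:Z + 1 * e%:Z by ring.
  by rewrite (apery_per Kf Ee).
exists s, l, m, K, p, q; split=> //.
- by move=> i Hi; exists (f (p i)%:Z); exact: bp.
- by move=> i Hi; exists (f (- (q i)%:Z)); exact: bq.
- move=> i; have [iK|iK] := leqP K i; first by rewrite l1.
  case: (posnP i) => [i0'|ip]; first by rewrite /l i0' eqxx; lia.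
  by have [|] := lP i; first lia.
- move=> i; have [iK|iK] := ltnP K i; first by have [] := mP i iK.
  case: (posnP i) => [i0'|ip]; first by rewrite /m i0' eqxx; lia.
  by rewrite m1 //; lia.
- by move=> i /lP[].
- by move=> i /mP[].
move=> j; have lj := ltn_ord j.
have [jn|jn] : (j = n.-1 :> nat \/ j < n.-1)%N by lia.
  have Sj : ordS j = 0%N :> nat by rewrite /= jn prednK ?modnn //; lia.
  rewrite l1; last lia.
  rewrite (b0 _ Sj) mul1n bq; last lia.
  rewrite jn q1 /m Sj eqxx PoszM gez0_abs; last lia.
  ring.
have Sj : ordS j = j.+1 :> nat by rewrite /= modn_small //; lia.
have [jK|jK] := leqP K j.
  have [|m0 Eq Ef] := mP (ordS j); first by rewrite Sj; lia.
  rewrite l1 // mul1n bq // PoszM bq; last by rewrite Sj; lia.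
  by rewrite Sj /= in Eq Ef *; rewrite Ef Eq; ring.
rewrite (m1 (ordS j)) ?mul1n; last by rewrite Sj; lia.
rewrite (bp (ordS j)) Sj; last lia.
case: (posnP j) => [j0|jp].
  by rewrite (b0 _ j0) j0 p1 /l j0 eqxx PoszM gez0_abs; [ring | lia].
have [|l0 Ep Ef] := lP j; first lia.
rewrite PoszM bp; last lia.
by rewrite Ef Ep; ring.
Qed.

End ArithmeticPF.

(** * Normal forms *)

Section Moves.

Variables (n : nat) (l m : 'I_n -> nat).

(* Exponent vectors, in the variables [Y_k], of the two entries of column [j]
   of the matrix. *)
Definition top_exp (j k : 'I_n) : nat := ((k == j) * l j)%N.
Definition bot_exp (j k : 'I_n) : nat := ((k == ordS j) * m (ordS j))%N.

Definition minor_exp (i j k : 'I_n) : nat := (top_exp i k + bot_exp j k)%N.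

(* No outward move, from [minor_exp j i] to [minor_exp i j] with [i < j],
   applies to [y]. *)
Definition normal (y : 'I_n -> nat) : Prop :=
  forall i j : 'I_n, (i < j)%N -> ~ (forall k, (minor_exp j i k <= y k)%N).

Definition weight (b y : 'I_n -> nat) : nat := (\sum_k y k * b k)%N.

Lemma weightD b y z :
  weight b (fun k => y k + z k)%N = (weight b y + weight b z)%N.
Proof. by rewrite /weight -big_split; apply: eq_bigr => k _; rewrite mulnDl. Qed.

Lemma weight_top b j : weight b (top_exp j) = (l j * b j)%N.
Proof. exact: sum_delta. Qed.

Lemma weight_bot b j : weight b (bot_exp j) = (m (ordS j) * b (ordS j))%N.
Proof. exact: sum_delta. Qed.

Lemma weight_minor b i j :
  weight b (minor_exp i j) = (l i * b i + m (ordS j) * b (ordS j))%N.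
Proof. by rewrite weightD weight_top weight_bot. Qed.

Hypothesis l_gt0 : forall i, (0 < l i)%N.
Hypothesis m_gt0 : forall i, (0 < m i)%N.

Lemma ordS_val (i : 'I_n) : (i.+1 < n)%N -> ordS i = i.+1 :> nat.
Proof. by move=> lt; rewrite /= modn_small. Qed.

Let C : nat := (\sum_k (l k + m k))%N.

Let C_ge k : (l k + m k <= C)%N.
Proof. by rewrite /C (bigD1 k) //= leq_addr. Qed.

(* Weighting [Y_k] by [C ^ (n - k)] with [C] large makes every outward move
   increase the total, as in the lexicographic order. *)
Let rank (y : 'I_n -> nat) : nat := weight (fun k => C ^ (n - k))%N y.

Lemma rank_move (i j : 'I_n) : (i < j)%N ->
  (weight (fun k => C ^ (n - k)) (minor_exp j i) <
   weight (fun k => C ^ (n - k)) (minor_exp i j))%N.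
Proof.
move=> ij; have lj := ltn_ord j; rewrite !weight_minor ordS_val; last lia.
have Ci := C_ge i; have Cj := C_ge j; have CS := C_ge (ordS i).
have l0 := l_gt0 i; have l0' := l_gt0 (ordS i); have l0'' := l_gt0 j.
have m0 := m_gt0 (ordS j); have m0' := m_gt0 (ordS i).
have C0 : (0 < C)%N by lia.
have X0 k : (0 < C ^ k)%N by rewrite expn_gt0 C0.
have E1 : (C ^ (n - i) = C * C ^ (n - i.+1))%N.
  by rewrite -expnS; congr (_ ^ _)%N; lia.
have h1 : (C ^ (n - i) <= l i * C ^ (n - i))%N by rewrite leq_pmull.
have h2 : (0 < m (ordS j) * C ^ (n - ordS j))%N by rewrite muln_gt0 m0 X0.
suff : (l j * C ^ (n - j) + m (ordS i) * C ^ (n - i.+1) <= C ^ (n - i))%N by lia.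
have [Ej|lt] : (j = i.+1 :> nat \/ i.+1 < j)%N by lia.
  have <- : j = ordS i by apply: val_inj; rewrite /= modn_small; lia.
  by rewrite -Ej -mulnDl E1 -Ej leq_pmul2r.
apply: (@leq_trans ((1 + m (ordS i)) * C ^ (n - i.+1))).
  rewrite mulnDl mul1n leq_add2r.
  apply: (@leq_trans (C ^ (n - j).+1)); first by rewrite expnS leq_pmul2r //; lia.
  by apply: leq_pexp2l => //; lia.
by rewrite E1 leq_pmul2r //; lia.
Qed.

(** Moves raise [rank], which is bounded at fixed weight. The invariant [P] is abstract to serve
    both for degrees and for congruence modulo the minors. *)
Lemma normalize (b : 'I_n -> nat) (h : nat) (P : ('I_n -> nat) -> Prop) :
  (forall k, 0 < b k)%N -> (forall y, P y -> weight b y = h) ->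
  (forall (i j : 'I_n) z, (i < j)%N -> P (fun k => z k + minor_exp j i k)%N ->
     P (fun k => z k + minor_exp i j k)%N) ->
  forall y, P y -> exists2 z, P z & normal z.
Proof.
move=> b0 Pw Pm.
have rank_le y : P y -> (rank y <= h * C ^ n)%N.
  move=> /Pw <-; rewrite /rank /weight big_distrl; apply: leq_sum => k _ /=.
  rewrite -mulnA leq_mul2l; apply/orP; right.
  have Ck := C_ge k; have lk := l_gt0 k; have bk := b0 k.
  apply: (@leq_trans (C ^ n)); last by rewrite leq_pmull.
  by apply: leq_pexp2l; lia.
move=> y; have [r] := ubnP (h * C ^ n - rank y); elim: r y => // r IH y lt Py.
have [nf|nnf] := classic (normal y); first by exists y.
have [i [j [ij le]]] : exists i j : 'I_n,
    (i < j)%N /\ forall k, (minor_exp j i k <= y k)%N.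
  apply: NNPP => nex; apply: nnf => i j ij le.
  by apply: nex; exists i, j.
pose z k := (y k - minor_exp j i k)%N.
have Ey : y = (fun k => z k + minor_exp j i k)%N.
  by apply: functional_extensionality => k; rewrite subnK.
rewrite {}Ey in Py lt.
have Pz := Pm _ _ _ ij Py.
apply: IH (Pz); have := rank_move ij; have := rank_le _ Pz; have := rank_le _ Py.
by move: lt; rewrite /rank !weightD; lia.
Qed.

(** [k] is the last positive index with [l k <= y k], or 1 if there is none. If [l k <= y k], the
    blocked move on columns [i - 1] and [k], which consumes [Y_k^(l k) Y_i^(m i)], bounds [y i] for
    [i <= k]. *)
Lemma normal_bound y : (1 < n)%N -> normal y ->
  exists2 k : 'I_n, (0 < k)%N &
    forall i : 'I_n, (0 < i)%N -> (y i < (k <= i) * l i + (i <= k) * m i)%N.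
Proof.
move=> n1 ny.
pose P := [pred i : 'I_n | (0 < i)%N && (l i <= y i)%N].
have [k [k0 kmax kl]] : exists k : 'I_n, [/\ (0 < k)%N,
    forall i, P i -> (i <= k)%N & k != 1%N :> nat -> (l k <= y k)%N].
  case: (pickP P) => [i1 Pi1|nP]; last first.
    by exists (Ordinal n1); split=> // i; rewrite nP.
  case: (@arg_maxnP _ i1 P val Pi1) => k /andP[k0 kl] kmax.
  by exists k; split.
have low (i : 'I_n) : (0 < i <= k)%N -> (l k <= y k)%N ->
    ~~ ((i != k) && (m i <= y i)%N || (i == k) && (l k + m k <= y k)%N).
  move=> Hi lk; apply/negP => Hm.
  have Ei : ordS (ord_pred i) = i by exact: ord_predK.
  have Vi : ord_pred i = i.-1 :> nat.
    rewrite /=; have -> : ((i + n).-1 = i.-1 + n)%N by lia.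
    by rewrite modnDr modn_small //; have := ltn_ord i; lia.
  apply: (ny (ord_pred i) k); first by rewrite Vi; lia.
  move=> x; rewrite /minor_exp /top_exp /bot_exp Ei.
  have [->|xk] := eqVneq x k; have [Exi|xi] := eqVneq; rewrite ?mul1n ?mul0n ?addn0 //.
  - by move: Hm; rewrite -Exi eqxx.
  - by move: Hm; rewrite -Exi xk (negbTE xk) orbF.
exists k => // i i0; have [ik|ki|Eik] := ltngtP i k.
- rewrite /= mul0n add0n mul1n.
  have lk : (l k <= y k)%N by apply: kl; lia.
  have := low i; rewrite i0 (ltnW ik) => /(_ isT lk).
  by have -> : i != k by [rewrite -val_eqE /=; lia]; rewrite /= negb_or -ltnNge; lia.
- have := kmax i; rewrite /P /= i0 /=; lia.
- have -> : i = k by exact: val_inj.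
  rewrite !mul1n ltnNge; apply/negP => le.
  have lk : (l k <= y k)%N by lia.
  by have := low k; rewrite k0 leqnn eqxx le orbT => /(_ isT lk).
Qed.

End Moves.

(** * Mixed radix expansions *)

Section Radix.

Variables (p L : nat -> nat) (K : nat).
Hypothesis p1 : p 1%N = 1%N.
Hypothesis pS : forall i, (0 < i < K)%N -> p i.+1 = (L i * p i).+1.

(** The digit at [k] may equal [L k]: as all lower digits vanish, the radix
    [p (k + 1) = L k * p k + 1] still exceeds the sum. *)
Definition digits (Y : nat -> nat) : Prop := exists k,
  (forall i, (0 < i < K)%N -> (i < k)%N -> Y i = 0%N) /\
  (forall i, (0 < i < K)%N -> (k <= i)%N -> (Y i < L i + (i == k))%N).

Definition digit_sum (Y : nat -> nat) (j : nat) : nat :=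
  (\sum_(1 <= i < j) Y i * p i)%N.

Lemma digit_sumS Y j : (0 < j)%N ->
  digit_sum Y j.+1 = (digit_sum Y j + Y j * p j)%N.
Proof. by move=> j0; rewrite /digit_sum big_nat_recr. Qed.

Lemma digit_sum_lt Y : digits Y -> forall j, (0 < j <= K)%N -> (digit_sum Y j < p j)%N.
Proof.
case=> k [Y0 YL]; elim=> // j IH Hj.
case: (posnP j) => [->|j0]; first by rewrite /digit_sum big_geq // p1.
have := IH; rewrite digit_sumS // pS; last lia.
have [jk|kj] := ltnP j k.
  rewrite Y0 // => [|]; last lia.
  suff -> : digit_sum Y j = 0%N by [].
  by rewrite /digit_sum big_nat big1 // => i Hi; rewrite Y0 //; lia.
have := YL j; have [Ejk|_] := eqVneq j k.
  suff -> : digit_sum Y j = 0%N by nia.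
  by rewrite /digit_sum big_nat big1 // => i Hi; rewrite Y0 //; lia.
by move=> h1 h2; nia.
Qed.

(** The lower digits sum to less than [p j], so leading digits agree. The digit at [K] is
    unrestricted. *)
Lemma digit_sum_inj Y Z : digits Y -> digits Z ->
  forall j, (j <= K.+1)%N -> digit_sum Y j = digit_sum Z j ->
  forall i, (0 < i < j)%N -> Y i = Z i.
Proof.
move=> dY dZ; elim=> [|j IH] jK E i Hi; first lia.
have j0 : (0 < j)%N by lia.
rewrite !digit_sumS // in E.
have jK' : (0 < j <= K)%N by lia.
have ltY := digit_sum_lt dY jK'; have ltZ := digit_sum_lt dZ jK'.
have EYZ : Y j = Z j by nia.
have [->//|ij] : i = j \/ (i < j)%N by lia.
by apply: IH; lia.
Qed.

End Radix.

(** * Uniqueness of normal forms in a given degree *)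

Section Uniqueness.

Variables (n e : nat) (alpha : int) (b l m : 'I_n -> nat) (K : nat) (p q : nat -> nat).
Hypothesis Ch : degree_chain e alpha b l m K p q.
Hypothesis e_gt0 : (0 < e)%N.
Hypothesis alpha_cancel : forall z t : int,
  z * alpha = t * e%:Z -> exists k : int, z = k * e%:Z.

Definition nat_ext (y : 'I_n -> nat) (t : nat) : nat := oapp y 0%N (insub t).

Lemma nat_ext_ord y (i : 'I_n) : nat_ext y i = y i.
Proof. by rewrite /nat_ext valK. Qed.

Lemma nat_ext_lt y t (lt : (t < n)%N) : nat_ext y t = y (Ordinal lt).
Proof. by rewrite -(nat_ext_ord y (Ordinal lt)). Qed.

Let coeff (t : nat) : int :=
  if t == 0%N then 0 else if (t <= K)%N then (p t)%:Z else - (q t)%:Z.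

Definition degree_index (y : 'I_n -> nat) : int :=
  \sum_(0 <= t < n) (nat_ext y t)%:Z * coeff t.

Lemma weight_index y :
  exists t : int, (weight b y)%:Z = degree_index y * alpha + t * e%:Z.
Proof.
have ex (i : 'I_n) : exists t : int, (b i)%:Z = coeff i * alpha + t * e%:Z.
  rewrite /coeff; case: eqVneq => [i0|i0].
    by exists 1; rewrite (chain_b0 Ch) // mul0r add0r mul1r.
  by case: leqP => iK; [apply: (chain_bp Ch) | apply: (chain_bq Ch)]; lia.
have [t Ht] := fin_all_exists ex.
exists (\sum_i (y i)%:Z * t i).
rewrite /weight /degree_index big_mkord !mulr_suml -big_split /=.
rewrite (big_morph Posz PoszD erefl).
by apply: eq_bigr => i _; rewrite nat_ext_ord PoszM Ht; ring.
Qed.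

(** The right half is reversed so that its radices increase too; column [K] counts on the left. *)
Lemma index_split y : degree_index y = (digit_sum p (nat_ext y) K.+1)%:Z
  - (digit_sum (fun t => q (n - t)%N) (fun t => nat_ext y (n - t)%N) (n - K))%:Z.
Proof.
have HK := chain_K Ch; rewrite /degree_index /digit_sum !(big_morph Posz PoszD erefl).
rewrite (big_cat_nat _ (n := 1)) //=; last lia.
rewrite big_nat1 /coeff eqxx mulr0 add0r.
rewrite (big_cat_nat _ (n := K.+1)) //=; last lia.
congr (_ + _).
  rewrite [LHS]big_nat [RHS]big_nat; apply: eq_bigr => i Hi.
  by rewrite ifN ?ifT ?PoszM //; lia.
rewrite -[K.+1]/(1 + K)%N big_addn -sumrN [RHS]big_nat_rev /=.
rewrite [LHS]big_nat [RHS]big_nat; apply: eq_bigr => i Hi.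
have -> : (n - (1 + (n - K) - i.+1) = i + K)%N by lia.
by rewrite ifN ?ifN ?PoszM ?mulrN //; lia.
Qed.


Let Lp (t : nat) : nat := nat_ext l t.
Let Lq (t : nat) : nat := nat_ext m (n - t).
Let p' (t : nat) : nat := q (n - t).
Let rv (y : 'I_n -> nat) (t : nat) : nat := nat_ext y (n - t).

Let LpS i : (0 < i < K)%N -> p i.+1 = (Lp i * p i).+1.
Proof.
move=> Hi; have HK := chain_K Ch; have lt : (i < n)%N by lia.
by rewrite /Lp (nat_ext_lt _ lt) (chain_p Ch (i := Ordinal lt)).
Qed.

Let LqS i : (0 < i < n - K)%N -> p' i.+1 = (Lq i * p' i).+1.
Proof.
move=> Hi; have HK := chain_K Ch; have lt : (n - i < n)%N by lia.
rewrite /Lq /p' (nat_ext_lt _ lt) -(chain_q Ch (i := Ordinal lt)) /=; last lia.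
by congr q; lia.
Qed.

Let p'1 : p' 1 = 1%N.
Proof. by rewrite /p' subn1 (chain_qn Ch). Qed.

(* A normal exponent vector involves, besides [Y_0], only variables on one side
   of column [K]. *)
Lemma normal_sides y : normal l m y ->
  [/\ digits Lp K (nat_ext y), digits Lq (n - K) (rv y)
    & (digit_sum p' (rv y) (n - K) = 0%N /\ (digit_sum p (nat_ext y) K.+1 <= p K)%N)
      \/ digit_sum p (nat_ext y) K.+1 = 0%N].
Proof.
have HK := chain_K Ch; move=> ny.
have [|k k0 yk] := normal_bound _ ny; first lia.
have lk := ltn_ord k.
have m1 t : (0 < t <= K)%N -> nat_ext m t = 1%N.
  move=> Ht; have lt : (t < n)%N by lia.
  by rewrite (nat_ext_lt _ lt) (chain_m1 Ch).
have l1 t : (K <= t < n)%N -> Lp t = 1%N.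
  move=> Ht; have lt : (t < n)%N by lia.
  by rewrite /Lp (nat_ext_lt _ lt) (chain_l1 Ch) //=; lia.
have yb t : (0 < t < n)%N -> [/\ (t < k)%N -> (nat_ext y t < nat_ext m t)%N,
    (k < t)%N -> (nat_ext y t < Lp t)%N &
    k = t :> nat -> (nat_ext y t < Lp t + nat_ext m t)%N].
  case/andP=> t0 lt; have := yk (Ordinal lt) t0; rewrite /Lp !(nat_ext_lt _ lt) /=.
  by case: ltngtP => /= tk; rewrite ?mul0n ?mul1n ?addn0 ?add0n; split=> //; lia.
have dl : digits Lp K (nat_ext y).
  exists k; split=> i Hi ik; have [|b1 b2 b3] := yb i; try lia.
    by have := b1 ik; rewrite m1; lia.
  have mi := m1 i; have [Ei|ne] := eqVneq i (k : nat); first by have := b3 (esym Ei); lia.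
  by have := b2; lia.
have dr : digits Lq (n - K) (rv y).
  exists (n - k)%N; split=> i Hi ik; have [|b1 b2 b3] := yb (n - i)%N;
    rewrite /rv /Lq; try lia.
    by have := b2; rewrite l1; lia.
  have li := l1 (n - i)%N; have [Ei|ne] := eqVneq i (n - k)%N; first by have := b3; lia.
  by have := b1; lia.
(* Exponents vanish at positive indices below [k] up to [K], where [m = 1], and at indices above [k]
   from [K] on, where [l = 1]. *)
split=> //; have [kK|Kk] := leqP k K; last first.
  right; rewrite /digit_sum big_nat big1 // => i Hi.
  suff -> : nat_ext y i = 0%N by [].
  by have [|b1 _ _] := yb i; [lia | move: b1; rewrite m1; lia].
left; split.
  rewrite /digit_sum big_nat big1 // => i Hi.
  suff -> : rv y i = 0%N by [].
  by rewrite /rv; have [|_ b2 _] := yb (n - i)%N; [lia | move: b2; rewrite l1; lia].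
rewrite digit_sumS; last lia.
have lt := digit_sum_lt (chain_p1 Ch) LpS dl (j := K).
have [|_ b2 b3] := yb K; first lia.
rewrite l1 ?m1 in b2 b3; try lia.
have [kK'|kK'] : (k < K \/ k = K :> nat)%N by lia.
  have -> : nat_ext y K = 0%N by have := b2 kK'; lia.
  by rewrite mul0n addn0 ltnW //; apply: lt; lia.
suff -> : digit_sum p (nat_ext y) K = 0%N.
  by rewrite add0n -{2}[p K]mul1n leq_mul2r; have := b3 kK'; lia.
rewrite /digit_sum big_nat big1 // => i Hi.
suff -> : nat_ext y i = 0%N by [].
by have [|b1 _ _] := yb i; [lia | move: b1; rewrite m1; lia].
Qed.

Lemma normal_unique y z :
  normal l m y -> normal l m z -> weight b y = weight b z -> y =1 z.
Proof.
have HK := chain_K Ch => ny nz E.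
have [dy dy' cy] := normal_sides ny; have [dz dz' cz] := normal_sides nz.
have [t Ey] := weight_index y; have [u Ez] := weight_index z.
have [k Ek] : exists k : int, degree_index y - degree_index z = k * e%:Z.
  by apply: (@alpha_cancel _ (u - t)); move: Ey; rewrite E Ez => Eyz; lia.
have bl w : digits Lq (n - K) (rv w) -> (digit_sum p' (rv w) (n - K) < p' (n - K))%N.
  by move=> dw; apply: (digit_sum_lt p'1 LqS dw); lia.
have Epq : p' (n - K) = q K by rewrite /p'; congr q; lia.
have pq := chain_pq Ch; have b1 := bl _ dy'; have b2 := bl _ dz'; rewrite Epq in b1 b2.
have Iy := index_split y; have Iz := index_split z.
rewrite -/(rv y) -/(rv z) -/p' in Iy Iz.
(* Both indices lie in [(- q K, p K]], which contains [e] integers, so congruent indices are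
   equal. *)
have Eyz : degree_index y = degree_index z.
  have [k0|[k0|k0]] : k = 0 \/ 1 <= k \/ k <= -1 by lia.
  - by rewrite k0 mul0r in Ek; lia.
  - by nia.
  - by nia.
have El : digit_sum p (nat_ext y) K.+1 = digit_sum p (nat_ext z) K.+1 by lia.
have Er : digit_sum p' (rv y) (n - K) = digit_sum p' (rv z) (n - K) by lia.
have yz0 i : i != 0%N :> nat -> (i < n)%N -> nat_ext y i = nat_ext z i.
  move=> i0 lt; have [iK|Ki] := leqP i K.
    by apply: (digit_sum_inj (chain_p1 Ch) LpS dy dz _ El); lia.
  have -> : i = (n - (n - i))%N by lia.
  by apply: (digit_sum_inj p'1 LqS dy' dz' _ Er (i := (n - i)%N)); lia.
have yz (i : 'I_n) : i != 0%N :> nat -> y i = z i.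
  by move=> i0; rewrite -(nat_ext_ord y) -(nat_ext_ord z); exact: yz0.
move=> i; case: (posnP i) => [i0|ip]; last by apply: yz; lia.
have := E; rewrite /weight (bigD1 i) //= [in RHS](bigD1 i) //=.
have -> : (\sum_(k < n | k != i) y k * b k = \sum_(k < n | k != i) z k * b k)%N.
  apply: eq_bigr => j ji; rewrite yz //; apply: contra ji => /eqP j0.
  by apply/eqP/val_inj; rewrite /= j0 i0.
by rewrite (chain_b0 Ch i0) => /addIn/eqP; rewrite eqn_pmul2r // => /eqP.
Qed.

End Uniqueness.

(** * The determinantal ideal *)

Section GeneratedIdeal.

Variables (R : comNzRingType) (G : R -> Prop).
Local Notation I := (in_ideal_generated G).

Lemma ideal0 : I 0.
Proof. by exists [::]; split=> //; rewrite big_nil. Qed.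

Lemma idealD x y : I x -> I y -> I (x + y).
Proof.
move=> [s [Gs ->]] [t [Gt ->]]; exists (s ++ t); split; last by rewrite big_cat.
by move=> u; rewrite mem_cat => /orP[/Gs|/Gt].
Qed.

Lemma idealM c x : I x -> I (c * x).
Proof.
move=> [s [Gs ->]]; exists [seq (c * u.1, u.2) | u <- s]; split.
  by move=> u /mapP[v vs ->] /=; exact: Gs.
by rewrite big_map big_distrr; apply: eq_bigr => u _; rewrite /= mulrA.
Qed.

Lemma ideal_gen x : G x -> I x.
Proof.
move=> Gx; exists [:: (1, x)]; split; last by rewrite big_seq1 mul1r.
by move=> u; rewrite inE => /eqP->.
Qed.

Lemma ideal_sum (J : Type) (r : seq J) (F : J -> R) :
  (forall j, I (F j)) -> I (\sum_(j <- r) F j).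
Proof.
by move=> IF; apply: (big_ind I); [exact: ideal0 | exact: idealD | move=> *; exact: IF].
Qed.

End GeneratedIdeal.

Lemma det_mx22 (R : comNzRingType) (A : 'M[R]_2) :
  \det A = A 0 0 * A 1 1 - A 0 1 * A 1 0.
Proof.
rewrite (expand_det_row _ ord0) !big_ord_recl big_ord0 /cofactor !det_mx11 !mxE /=.
rewrite !addr0 expr0 mul1r expr1 mulN1r mulrN.
by congr (A _ _ * A _ _ - A _ _ * A _ _); apply: val_inj.
Qed.

(** * Binomials in the kernel and in the ideal of minors *)

Section Binomials.

Variables (K : fieldType) (n : nat) (a : 'I_n -> nat) (s : 'S_n) (l m : 'I_n -> nat).

Local Notation b := (fun i => a (s i)).
Local Notation I := (in_minor_ideal 2 (cyclic_matrix K s l m)).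

(** Exponent vectors are indexed by the [Y_j], hence the inverse permutation. *)
Definition monom (y : 'I_n -> nat) : 'X_{1..n} := [multinom y ((s^-1)%g i) | i < n].
Local Notation Y y := ('X_[monom y] : {mpoly K[n]}).

Lemma monom_comp (u : 'X_{1..n}) : monom (fun j => u (s j)) = u.
Proof. by apply/mnmP => i; rewrite mnmE permKV. Qed.

Lemma monomE y j : monom y (s j) = y j.
Proof. by rewrite mnmE permK. Qed.

Lemma monomD y z : monom (fun k => y k + z k)%N = (monom y + monom z)%MM.
Proof. by apply/mnmP => i; rewrite mnmDE !mnmE. Qed.

Lemma monom_delta j c : 'X_(s j) ^+ c = Y (fun k => (k == j) * c)%N.
Proof.
rewrite [RHS](mpolyXE _ s) (bigD1 j) //= big1 ?mulr1 => [|i /negbTE ij].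
  by rewrite monomE eqxx mul1n.
by rewrite monomE ij mul0n expr0.
Qed.

Lemma minor_binomial i j :
  cyclic_matrix K s l m 0 i * cyclic_matrix K s l m 1 j -
  cyclic_matrix K s l m 0 j * cyclic_matrix K s l m 1 i =
  Y (minor_exp l m i j) - Y (minor_exp l m j i).
Proof. by rewrite !mxE /= !monom_delta -!mpolyXD -!monomD. Qed.

Lemma is_minorP d : is_minor 2 (cyclic_matrix K s l m) d <->
  exists i j : 'I_n, (i < j)%N /\ d = Y (minor_exp l m i j) - Y (minor_exp l m j i).
Proof.
split=> [[f [g [fmono gmono ->]]]|[i [j [ij ->]]]].
  exists (g 0), (g 1); split; first exact: gmono.
  rewrite det_mx22 !mxE -minor_binomial.
  have := fmono 0 1 isT; have := ltn_ord (f 1) => f1 f01.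
  have -> : f 0 = 0 by apply: val_inj; move: f1 f01 => /=; lia.
  have -> : f 1 = 1 by apply: val_inj; move: f1 f01 => /=; lia.
  by rewrite !mxE.
exists id, (fun k => if k == 0 then i else j); split=> //.
  move=> x y xy; have := ltn_ord y => y2; rewrite ifT ?ifN // -val_eqE /=; lia.
by rewrite det_mx22 -minor_binomial !mxE.
Qed.

Lemma semigroup_mapX u : semigroup_map a ('X_[u] : {mpoly K[n]}) = 'X^(\sum_i u i * a i).
Proof.
rewrite /semigroup_map mmapX /mmap1 (big_morph (fun k => 'X^k) (@exprD _ 'X) (expr0 _)).
by apply: eq_bigr => i _; rewrite mulnC exprM.
Qed.

Lemma semigroup_mapY y : semigroup_map a (Y y) = 'X^(weight b y).
Proof.
rewrite semigroup_mapX /weight (reindex_inj (@perm_inj _ s)) /=.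
by congr 'X^_; apply: eq_bigr => i _; rewrite monomE.
Qed.

Lemma semigroup_mapD (f g : {mpoly K[n]}) :
  semigroup_map a (f + g) = semigroup_map a f + semigroup_map a g.
Proof. exact: mmapD. Qed.

Lemma semigroup_mapB (f g : {mpoly K[n]}) :
  semigroup_map a (f - g) = semigroup_map a f - semigroup_map a g.
Proof. exact: mmapB. Qed.

Lemma semigroup_mapM (f g : {mpoly K[n]}) :
  semigroup_map a (f * g) = semigroup_map a f * semigroup_map a g.
Proof. exact: rmorphM. Qed.

Lemma semigroup_mapE (f : {mpoly K[n]}) :
  semigroup_map a f = \sum_(u <- msupp f) f@_u *: 'X^(\sum_i u i * a i).
Proof.
rewrite {1}[f]mpolyE /semigroup_map raddf_sum /=; apply: eq_bigr => u _.
by rewrite mmapZ -semigroup_mapX mul_polyC.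
Qed.


Lemma minor_in_ideal i j : I (Y (minor_exp l m i j) - Y (minor_exp l m j i)).
Proof.
have [ij|ji|/val_inj->] := ltngtP i j; last by rewrite subrr; exact: ideal0.
  by apply: ideal_gen; apply/is_minorP; exists i, j.
rewrite -opprB -mulN1r; apply: idealM; apply: ideal_gen.
by apply/is_minorP; exists j, i.
Qed.

Lemma minor_ideal_sub_kernel :
  (forall i j, weight b (minor_exp l m i j) = weight b (minor_exp l m j i)) ->
  forall f, I f -> semigroup_map a f = 0.
Proof.
move=> wE f [t [Gt ->]]; rewrite big_seq; elim/big_ind: _ => [|x y Hx Hy|u /Gt].
- by rewrite /semigroup_map mmap0.
- by rewrite semigroup_mapD Hx Hy addr0.
move=> /is_minorP[i [j [_ ->]]].
by rewrite semigroup_mapM semigroup_mapB !semigroup_mapY wE subrr mulr0.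
Qed.

Lemma kernel_sub_minor_ideal :
  (forall y z, weight b y = weight b z -> I (Y y - Y z)) ->
  forall f, semigroup_map a f = 0 -> I f.
Proof.
move=> cong f f0.
pose w (u : 'X_{1..n}) := (\sum_i u i * a i)%N.
have wY (u : 'X_{1..n}) : w u = weight b (fun j => u (s j)).
  by rewrite /w /weight (reindex_inj (@perm_inj _ s)).
pose rep (h : nat) : 'X_{1..n} := epsilon (inhabits 0%MM) (fun u => w u = h).
have wrep u : w (rep (w u)) = w u.
  by apply: (epsilon_spec (inhabits 0%MM) (fun v => w v = w u)); exists u.
pose N := (\max_(u <- msupp f) w u).+1.
(* The subtracted representatives, grouped by degree, carry the coefficients of the image of [f],
   which are zero. *)
have Ef : f = \sum_(u <- msupp f) f@_u *: ('X_[u] - 'X_[rep (w u)]).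
  apply/eqP; rewrite (eq_bigr _ (fun u _ => scalerBr _ _ _)) sumrB -mpolyE -subr_eq0.
  rewrite opprB addrC subrK; apply/eqP.
  transitivity (\sum_(h < N) (semigroup_map a f)`_h *:
      ('X_[rep h] : {mpoly K[n]})); last first.
    by rewrite f0 big1 // => h _; rewrite coef0 scale0r.
  transitivity (\sum_(u <- msupp f) \sum_(h < N)
      (f@_u * (h == w u :> nat)%:R) *: ('X_[rep h] : {mpoly K[n]})).
    apply: eq_big_seq => u uf.
    have lt : (w u < N)%N by rewrite ltnS; exact: (leq_bigmax_seq u).
    rewrite (bigD1 (Ordinal lt)) //= eqxx mulr1 big1 ?addr0 // => h.
    by rewrite -val_eqE /= => /negbTE->; rewrite mulr0 scale0r.
  rewrite exchange_big; apply: eq_bigr => h _; rewrite -scaler_suml; congr (_ *: _).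
  rewrite semigroup_mapE coef_sum; apply: eq_bigr => u _.
  by rewrite coefZ coefXn.
rewrite Ef; apply: ideal_sum => u; rewrite -mul_mpolyC; apply: idealM.
rewrite -(monom_comp u) -(monom_comp (rep _)); apply: cong.
by rewrite -!wY monom_comp wrep.
Qed.

(** [x k] counts the flips of column [k] from top to bottom; [Y_k] is on top of column [k] and at
    the bottom of the preceding one. *)
Definition lattice_equiv (y z : 'I_n -> nat) : Prop := exists x : 'I_n -> int,
  \sum_k x k = 0 /\
  forall k, (z k)%:Z = (y k)%:Z - (l k)%:Z * x k + (m k)%:Z * x (ord_pred k).

Lemma sum_delta_int (i : 'I_n) : \sum_k (k == i)%:Z = 1.
Proof. by rewrite (bigD1 i) //= eqxx big1 ?addr0 // => k /negbTE->. Qed.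

Lemma lattice_equiv_move y z i j :
  lattice_equiv y (fun k => z k + minor_exp l m i j k)%N ->
  lattice_equiv y (fun k => z k + minor_exp l m j i k)%N.
Proof.
case=> x [x0 Ex]; exists (fun k => x k + (k == i)%:Z - (k == j)%:Z); split.
  by rewrite sumrB big_split /= x0 !sum_delta_int.
move=> k; have := Ex k; rewrite /minor_exp /top_exp /bot_exp.
have pE r : (ord_pred k == r) = (k == ordS r).
  by rewrite (can2_eq (@ord_predK n) (@ordSK n)).
have T r : ((k == r) * l r)%N = ((k == r) * l k)%N by case: eqVneq => [->|].
have B r : ((k == ordS r) * m (ordS r))%N = ((k == ordS r) * m k)%N.
  by case: eqVneq => [->|].
rewrite !pE !T !B !PoszD !PoszM; lia.
Qed.

Hypothesis b_gt0 : forall k, (0 < b k)%N.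
Variable d : int.
Hypothesis rel : forall k, (l k * b k)%N%:Z + d = (m (ordS k) * b (ordS k))%N%:Z.

Lemma flip_weight (x : 'I_n -> int) :
  \sum_k (- ((l k)%:Z * x k) + (m k)%:Z * x (ord_pred k)) * (b k)%:Z =
  d * \sum_k x k.
Proof.
under eq_bigr => k _ do rewrite mulrDl.
rewrite big_split /= [X in _ + X](reindex_inj (@ordS_inj n)) -big_split mulr_sumr.
apply: eq_bigr => k _ /=; rewrite ordSK; have := rel k; rewrite /= !PoszM => E.
have -> : (m (ordS k))%:Z * x k * (b (ordS k))%:Z =
  x k * ((m (ordS k))%:Z * (b (ordS k))%:Z) by ring.
by rewrite -E; ring.
Qed.

Lemma lattice_equiv_weight y z : lattice_equiv y z -> weight b y = weight b z.
Proof.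
case=> x [x0 Ex]; apply/eqP; rewrite -eqz_nat; apply/eqP.
rewrite /weight !(big_morph Posz PoszD erefl).
transitivity (\sum_k (y k * b k)%N%:Z + d * \sum_k x k); first by rewrite x0 mulr0 addr0.
rewrite -flip_weight -big_split; apply: eq_bigr => k _ /=.
by rewrite !PoszM Ex; ring.
Qed.

(** Summing coefficients over the class of [y] is a linear functional. It kills the monomial
    multiples of minors, as moves preserve the class, hence also [Y y - Y z]; so [z] is in the
    class. *)
Lemma kernel_lattice y z :
  (forall f, semigroup_map a f = 0 -> I f) ->
  weight b y = weight b z -> lattice_equiv y z.
Proof.
move=> kerI E.
pose chi (u : 'X_{1..n}) : K :=
  if excluded_middle_informative (lattice_equiv y (fun j => u (s j))) then 1 else 0.
have chi1 u : chi u = 1 -> lattice_equiv y (fun j => u (s j)).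
  by rewrite /chi; case: excluded_middle_informative => // _ /esym/eqP; rewrite oner_eq0.
have chiE (u v : 'X_{1..n}) :
    (lattice_equiv y (fun j => u (s j)) <-> lattice_equiv y (fun j => v (s j))) ->
    chi u = chi v.
  rewrite /chi => uv; do 2!case: excluded_middle_informative => //=;
    by move=> h1 h2; exfalso; tauto.
have ext v1 : (fun j1 : 'I_n => monom v1 (s j1)) = v1.
  by apply: functional_extensionality => k; rewrite monomE.
pose h := weight b y.
(* The degree bound keeps the sum finite and loses nothing: monomials of the class have weight [h],
   and all [b k] are positive. *)
pose Phi (f : {mpoly K[n]}) := \sum_(u : 'X_{1..n < h.+1}) f@_u * chi u.
have PhiX u : Phi 'X_[u] = chi u.
  rewrite /Phi; have [lt|ge] := ltnP (mdeg u) h.+1.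
    rewrite (bigD1 (BMultinom lt)) //= mcoeffX eqxx mul1r big1 ?addr0 // => v nv.
    rewrite mcoeffX; case: eqVneq => [uv|]; last by rewrite mul0r.
    by case/eqP: nv; apply: val_inj; rewrite /= -uv.
  have -> : chi u = 0.
    rewrite /chi; case: excluded_middle_informative => // le.
    have Eu := lattice_equiv_weight le.
    suff : (mdeg u <= h)%N by lia.
    rewrite mdegE /h Eu /weight (reindex_inj (@perm_inj _ s)) /=.
    by apply: leq_sum => i _; rewrite leq_pmulr.
  rewrite big1 // => v _; rewrite mcoeffX; case: eqVneq => [uv|]; last by rewrite mul0r.
  by have := bmdeg v; rewrite -uv; lia.
have Phi_sum (J : eqType) (r : seq J) (G : J -> {mpoly K[n]}) :
    Phi (\sum_(j <- r) G j) = \sum_(j <- r) Phi (G j).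
  rewrite /Phi exchange_big; apply: eq_bigr => u _.
  by rewrite raddf_sum mulr_suml.
have PhiZ c f : Phi (c *: f) = c * Phi f.
  by rewrite /Phi mulr_sumr; apply: eq_bigr => u _; rewrite mcoeffZ mulrA.
have PhiB f g : Phi (f - g) = Phi f - Phi g.
  by rewrite /Phi -sumrB; apply: eq_bigr => u _; rewrite mcoeffB mulrBl.
have Phi0 f : I f -> Phi f = 0.
  case=> t [Gt ->]; rewrite Phi_sum big_seq big1 // => v /Gt/is_minorP[i [j [_ ->]]].
  rewrite [v.1]mpolyE mulr_suml Phi_sum big1 // => u _.
  rewrite -scalerAl PhiZ mulrBr PhiB -!mpolyXD !PhiX.
  suff -> : chi (u + monom (minor_exp l m i j))%MM =
            chi (u + monom (minor_exp l m j i))%MM.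
    by rewrite subrr mulr0.
  apply: chiE; rewrite -[in X in X <-> _](monom_comp u).
  rewrite -[in X in _ <-> X](monom_comp u) -!monomD.
  by rewrite !ext; split; exact: lattice_equiv_move.
suff /chi1 : chi (monom z) = 1 by rewrite ext.
have -> : 1 = chi (monom y).
  rewrite /chi; case: excluded_middle_informative => // -[].
  by rewrite ext; exists (fun=> 0); split=> [|k]; rewrite ?big1 // !mulr0 subr0 addr0.
have := Phi0 _ (kerI (Y y - Y z) _).
rewrite PhiB !PhiX semigroup_mapB !semigroup_mapY E subrr.
by move=> /(_ erefl)/eqP; rewrite subr_eq0 => /eqP.
Qed.

End Binomials.

(** * Pseudo-Frobenius numbers of a determinantal semigroup *)

Lemma ord_pred_val n (i : 'I_n) :
  ord_pred i = (if i == 0%N :> nat then n.-1 else i.-1) :> nat.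
Proof.
have li := ltn_ord i; rewrite /=; case: eqVneq => [->|i0].
  by rewrite add0n modn_small //; lia.
have -> : ((i + n).-1 = i.-1 + n)%N by lia.
by rewrite modnDr modn_small //; lia.
Qed.

Lemma ordS_ind n (P : 'I_n -> Prop) (j0 : 'I_n) :
  P j0 -> (forall j, P j -> P (ordS j)) -> forall j, P j.
Proof.
move=> P0 PS j; have lj := ltn_ord j; have lj0 := ltn_ord j0.
have iterP t : P (iter t (@ordS n) j0) by elim: t => //= t; exact: PS.
have iterV t : iter t (@ordS n) j0 = ((j0 + t) %% n)%N :> nat.
  elim: t => [|t IH]; first by rewrite addn0 modn_small.
  by rewrite iterS /= IH -addn1 modnDml addn1 addnS.
have -> : j = iter (j + n - j0) (@ordS n) j0; last exact: iterP.
apply: val_inj; rewrite /= iterV.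
have -> : (j0 + (j + n - j0) = j + n)%N by lia.
by rewrite modnDr modn_small.
Qed.

(** Otherwise one nonpositive value propagates around the cycle and the sum is nonpositive; without
    any such value the sum is at least [n]. *)
Lemma cyclic_descent n (w : 'I_n -> int) : 0 < \sum_i w i < n%:Z ->
  exists j, 0 < w j /\ w (ord_pred j) <= 0.
Proof.
move=> Hw; apply: NNPP => nex.
have step j : w j <= 0 -> w (ordS j) <= 0.
  move=> wj; rewrite leNgt; apply/negP => ws; apply: nex; exists (ordS j).
  by rewrite ordSK.
have [[j0 w0]|all_pos] := classic (exists j, w j <= 0).
  have all_neg : forall j, w j <= 0 by exact: (ordS_ind w0).
  have : \sum_i w i <= 0 by apply: sumr_le0.
  lia.
have pos j : 1 <= w j.
  by have [//|le] := leP 1 (w j); case: all_pos; exists j; lia.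
have : \sum_(i < n) 1 <= \sum_i w i by apply: ler_sum.
by rewrite sumr_const card_ord natz; lia.
Qed.

Lemma sum_lt_ord n k : (k <= n)%N -> \sum_(i < n) (i < k)%N%:Z = k%:Z.
Proof.
move=> kn; rewrite -(big_mkord xpredT (fun i => (i < k)%N%:Z)).
rewrite (big_cat_nat _ (n := k)) //= big_nat (eq_bigr (fun=> 1)) => [|i /andP[_ ->] //].
rewrite -big_nat [X in _ + X]big_nat [X in _ + X]big1 ?addr0 => [|i Hi].
  by rewrite big_const_nat subn0 iter_addr_0 natz.
by rewrite ltnNge; case/andP: Hi => ->.
Qed.

Lemma sum_delta_mul n (j : 'I_n) (F : 'I_n -> int) : \sum_i (i == j)%:Z * F i = F j.
Proof.
by rewrite (bigD1 j) //= eqxx mul1r big1 ?addr0 // => i /negbTE->; rewrite mul0r.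
Qed.

(* The indicator function of the cyclic interval [j, j + k). *)
Lemma cyclic_interval n (j : 'I_n) k : (k <= n)%N -> exists x : 'I_n -> bool,
  \sum_i (x i)%:Z = k%:Z /\ (forall i, i != j -> x i -> x (ord_pred i)).
Proof.
move=> kn; have lj := ltn_ord j.
pose r (i : 'I_n) : nat := if (j <= i)%N then (i - j)%N else (i + n - j)%N.
have rn i : (r i < n)%N by have := ltn_ord i; rewrite /r; case: (leqP j i); lia.
pose r' i := Ordinal (rn i).
have r'inj : injective r'.
  move=> i i' /(congr1 val) /=; have := ltn_ord i; have := ltn_ord i'; rewrite /r.
  move=> h h' E; apply: val_inj => /=; move: E.
  by case: (leqP j i); case: (leqP j i'); lia.
exists (fun i => (r i < k)%N); split.
  by rewrite -[RHS](sum_lt_ord kn) [RHS](reindex_inj r'inj).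
move=> i ij; have : i <> j :> nat by move/val_inj/eqP; rewrite (negbTE ij).
have := ltn_ord i; have := ord_pred_val i; rewrite /r; set v := nat_of_ord (ord_pred i).
case: (posnP i) => [->|ip] -> li ne; first by case: (leqP j 0); case: (leqP j n.-1); lia.
by case: (leqP j i); case: (leqP j i.-1); lia.
Qed.

Section MatrixToPF.

Variables (H : {pred nat}) (n : nat) (a : 'I_n -> nat) (i0 : 'I_n).
Hypothesis Hsg : numerical_semigroup H.
Hypothesis Hgen : minimally_generated_by H a.
Hypothesis n_gt1 : (1 < n)%N.
Variables (s : 'S_n) (l m : 'I_n -> nat) (d : int).

Let b : 'I_n -> nat := fun i => a (s i).

Hypothesis l_gt0 : forall i, (0 < l i)%N.
Hypothesis m_gt0 : forall i, (0 < m i)%N.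
Hypothesis rel : forall k, (l k * b k)%N%:Z + d = (m (ordS k) * b (ordS k))%N%:Z.
Hypothesis lattice : forall y z, weight b y = weight b z -> lattice_equiv l m y z.

Local Notation inH := (int_mem H).

Let b_gt0 k : (0 < b k)%N. Proof. exact: gen_gt0 Hgen _. Qed.

Lemma mem_weight x : inH x <-> exists y, x = (weight b y)%:Z.
Proof.
split=> [/int_memP[k /(mem_genP Hgen)[c ->] ->]|[y ->]].
  by exists (fun i => c (s i)); rewrite /weight [in LHS](reindex_inj (@perm_inj _ s)).
apply/(mem_genP Hgen); exists (fun i => y ((s^-1)%g i)).
rewrite /weight [RHS](reindex_inj (@perm_inj _ s)).
by apply: eq_bigr => i _; rewrite permK.
Qed.

Lemma mem_sum (c : 'I_n -> int) : (forall k, 0 <= c k) -> inH (\sum_k c k * (b k)%:Z).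
Proof.
move=> c0; apply/mem_weight; exists (fun k => absz (c k)).
rewrite /weight (big_morph Posz PoszD erefl); apply: eq_bigr => k _.
by rewrite PoszM gez0_abs.
Qed.

Definition pf_candidate (k : nat) : int := \sum_i ((l i)%:Z - 1) * (b i)%:Z + k%:Z * d.

(* Flipping the columns selected by [x] from their top entry to their bottom
   entry changes the degree by [d] per column. *)
Definition flip (x : 'I_n -> int) (i : 'I_n) : int :=
  (l i)%:Z * (1 - x i) + (m i)%:Z * x (ord_pred i).

Lemma flip_sum (x : 'I_n -> int) (k : nat) (t : 'I_n -> int) : \sum_i x i = k%:Z ->
  \sum_i (flip x i - t i) * (b i)%:Z =
  pf_candidate k + \sum_i (1 - t i) * (b i)%:Z.
Proof.
move=> xk; have := flip_weight rel x; rewrite xk /pf_candidate [k%:Z * d]mulrC => <-.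
by rewrite -!big_split; apply: eq_bigr => i _ /=; rewrite /flip; ring.
Qed.

(** Membership yields a monomial with all exponents positive that arises from [k] flips in total. By
    [cyclic_descent] some column [j] is flipped and the preceding one is not, so the exponent of
    [Y_j] is nonpositive. *)
Lemma pf_candidate_not k : (0 < k < n)%N -> ~~ inH (pf_candidate k).
Proof.
move=> Hk; apply/negP => /mem_weight[y Ey].
have j0 : 'I_n := Ordinal (ltnW n_gt1).
have [x [xk xj]] := cyclic_interval j0 (ltnW (proj2 (andP Hk))).
pose X i := (x i)%:Z.
have u0 i : 0 <= flip X i by rewrite /flip /X; nia.
have E : weight b (fun i => absz (flip X i)) = weight b (fun i => y i + 1)%N.
  apply/eqP; rewrite -eqz_nat; apply/eqP.
  transitivity (\sum_i (flip X i - 0) * (b i)%:Z).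
    rewrite /weight (big_morph Posz PoszD erefl); apply: eq_bigr => i _.
    by rewrite PoszM gez0_abs // subr0.
  rewrite (flip_sum (k := k) (fun=> 0)) // Ey /weight.
  rewrite !(big_morph Posz PoszD erefl) -big_split.
  by apply: eq_bigr => i _ /=; rewrite !PoszM PoszD; ring.
have [w [w0 Ew]] := lattice E.
have [|j [j1 j2]] := @cyclic_descent n (fun i => X i + w i).
  by rewrite big_split /= w0 addr0 xk; lia.
have := Ew j; rewrite gez0_abs // PoszD /flip => Ej.
have : (y j)%:Z + 1 = (l j)%:Z * (1 - (X j + w j)) +
    (m j)%:Z * (X (ord_pred j) + w (ord_pred j)).
  by rewrite Ej; ring.
have h1 : (l j)%:Z * (1 - (X j + w j)) <= 0 by rewrite pmulr_rle0 ?ltz_nat //; lia.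
have h2 : (m j)%:Z * (X (ord_pred j) + w (ord_pred j)) <= 0.
  by rewrite pmulr_rle0 ?ltz_nat //; lia.
lia.
Qed.

(** Flipping [k] consecutive columns from [j] on leaves every [Y_i] with [i != j] a positive
    exponent, so their product can be divided out. *)
Lemma pf_candidate_add k j : (k <= n)%N -> inH (pf_candidate k + (b j)%:Z).
Proof.
move=> kn; have [x [xk xj]] := cyclic_interval j kn.
have := mem_sum (c := fun i => flip (fun i => (x i)%:Z) i - (i != j)%:Z).
rewrite (flip_sum _ xk).
have -> : \sum_i (1 - (i != j)%:Z) * (b i)%:Z = (b j)%:Z.
  by rewrite (bigD1 j) //= eqxx subr0 mul1r big1 ?addr0 // => i ->; rewrite subrr mul0r.
apply=> i; rewrite /flip; have l0 := l_gt0 i; have m0 := m_gt0 i.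
have [->|ij] := eqVneq i j; first by nia.
by have := xj i ij; case: (x i) => [-> //|_]; nia.
Qed.

Lemma d_neq0 : d != 0.
Proof.
apply/eqP => d0; have := @pf_candidate_not 1%N; rewrite n_gt1 => /(_ isT)/negP; apply.
rewrite /pf_candidate d0 mulr0 addr0; apply: mem_sum => i.
by have := l_gt0 i; lia.
Qed.

Lemma pf_candidate_pf k : (0 < k < n)%N -> int_pseudo_frobenius H (pf_candidate k).
Proof.
move=> Hk; split; first exact: pf_candidate_not.
move=> y /mem_weight[z ->] z0.
have [j zj] : exists j, (0 < z j)%N.
  apply: NNPP => nex; move: z0; rewrite /weight big1 // => i _.
  by case: (posnP (z i)) => [->//|zi]; case: nex; exists i.
have -> : (weight b z)%:Z = (b j)%:Z + \sum_i ((z i)%:Z - (i == j)%:Z) * (b i)%:Z.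
  under eq_bigr => i _ do rewrite mulrBl.
  rewrite sumrB sum_delta_mul addrC subrK /weight (big_morph Posz PoszD erefl).
  by under eq_bigr do rewrite PoszM.
rewrite addrA; apply: (int_memD Hsg); first by apply: pf_candidate_add; lia.
by apply: mem_sum => i; case: eqVneq => [->|]; lia.
Qed.

Lemma pf_is_candidate p : int_pseudo_frobenius H p ->
  exists2 k : nat, (1 <= k <= n - 1)%N & p = pf_candidate k.
Proof.
move=> [np pp]; pose c0 : 'I_n := Ordinal (ltnW n_gt1).
have /mem_weight[y Ey] : inH (p + (b c0)%:Z).
  by apply: pp; [exact: int_mem_gen Hgen _ | rewrite ltz_nat].
have wmove i j : weight b (minor_exp l m i j) = weight b (minor_exp l m j i).
  by rewrite !weight_minor; have := rel i; have := rel j; lia.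
have [|//|z Ez nz] := normalize l_gt0 m_gt0 b_gt0 (h := weight b y)
    (P := fun z => weight b z = weight b y) _ _ (erefl (weight b y)); first by [].
  move=> i j z ij; rewrite (weightD b z (minor_exp l m i j)) wmove.
  by rewrite (weightD b z (minor_exp l m j i)).
(* A factor [Y_0] could be cancelled, putting [p] in [H]. *)
have z0 : z c0 = 0%N.
  case: (posnP (z c0)) => // z0; case/negP: np.
  have -> : p = \sum_i ((z i)%:Z - (i == c0)%:Z) * (b i)%:Z.
    under eq_bigr => i _ do rewrite mulrBl.
    rewrite sumrB sum_delta_mul; apply/eqP; rewrite eq_sym subr_eq Ey -Ez /weight.
    by rewrite (big_morph Posz PoszD erefl); apply/eqP/eq_bigr => i _; rewrite PoszM.
  by apply: mem_sum => i; case: eqVneq => [->|]; lia.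
have [k k0 zk] := normal_bound n_gt1 nz; have lk := ltn_ord k.
have Hk : (0 < k < n)%N by rewrite k0.
(* Flipping the first [k] columns produces exactly the bounds of [normal_bound], so
   [pf_candidate k - p] is a nonnegative combination. *)
have xk := sum_lt_ord (ltnW lk).
have Hdiff : inH (pf_candidate k - p).
  have -> : pf_candidate k - p = \sum_i (flip (fun i : 'I_n => (i < k)%N%:Z) i
      - ((z i)%:Z + (i != c0)%:Z)) * (b i)%:Z.
    rewrite (flip_sum _ xk).
    have -> : p = (weight b z)%:Z - (b c0)%:Z by rewrite Ez -Ey; ring.
    rewrite opprB; congr (_ + _).
    rewrite -(sum_delta_mul c0 (fun i => (b i)%:Z)) /weight (big_morph Posz PoszD erefl).
    rewrite -sumrB; apply: eq_bigr => i _; rewrite PoszM.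
    by case: eqVneq => _ /=; ring.
  apply: mem_sum => i; rewrite /flip ord_pred_val.
  have [i00|ip] := posnP i.
    have -> : i = c0 by apply: val_inj; rewrite /= i00.
    rewrite z0 eqxx /= k0 ltnNge; have -> : (k <= n.-1)%N by lia.
    by rewrite !mulr0 subrr.
  have := zk i ip; have -> : i != c0 by rewrite -val_eqE /=; lia.
  have -> : (i.-1 < k)%N = (i <= k)%N by lia.
  by rewrite [(k <= i)%N]leqNgt; case: ltnP; case: leqP; rewrite ?mul0n ?mul1n; lia.
exists k; first lia.
apply/eqP; apply: contraT => ne; have := pf_candidate_not Hk.
have -> : pf_candidate k = p + (pf_candidate k - p) by ring.
rewrite pp //; have := int_mem_ge0 Hdiff.
by move: ne; rewrite eq_sym -subr_eq0; lia.
Qed.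

End MatrixToPF.

(** * The two implications *)

Section Equivalence.

Variables (K : fieldType) (H : {pred nat}) (n : nat) (a : 'I_n -> nat) (i0 : 'I_n).
Hypothesis Hsg : numerical_semigroup H.
Hypothesis n_ge3 : (3 <= n)%N.
Hypothesis Hgen : minimally_generated_by H a.
Hypothesis Hleast : is_least_nonzero H (a i0).

Let n_gt1 : (1 < n)%N := ltnW n_ge3.

Lemma arithmetic_pf_of_matrix (s : 'S_n) (l m : 'I_n -> nat) :
  (forall i, (0 < l i)%N /\ (0 < m i)%N) ->
  (forall f : {mpoly K[n]},
     in_semigroup_ideal a f <-> in_minor_ideal 2 (cyclic_matrix K s l m) f) ->
  exists h alpha : int, alpha != 0 /\
    forall z : int, int_pseudo_frobenius H z <->
      exists2 j : nat, (1 <= j <= n - 1)%N & z = h + j%:Z * alpha.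
Proof.
move=> lm0 IE; have l0 i := (lm0 i).1; have m0 i := (lm0 i).2.
pose b i := a (s i).
have wE i j : weight b (minor_exp l m i j) = weight b (minor_exp l m j i).
  have /IE := minor_in_ideal K s l m i j.
  rewrite /in_semigroup_ideal semigroup_mapB !semigroup_mapY => /eqP.
  rewrite subr_eq0 => /eqP/(congr1 (fun p : {poly K} => size p)).
  by rewrite !size_polyXn => -[].
pose c0 : 'I_n := Ordinal (ltnW n_gt1).
(* Homogeneity of the minors makes the degree jump from top to bottom the same in every column. *)
pose d : int := (m (ordS c0) * b (ordS c0))%N%:Z - (l c0 * b c0)%N%:Z.
have rel k : (l k * b k)%N%:Z + d = (m (ordS k) * b (ordS k))%N%:Z.
  by have := wE k c0; rewrite !weight_minor /d; lia.
have b0 k : (0 < b k)%N by exact: gen_gt0 Hgen _.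
have lat y z : weight b y = weight b z -> lattice_equiv l m y z.
  by apply: (kernel_lattice b0 rel) => f /IE.
exists (\sum_i ((l i)%:Z - 1) * (b i)%:Z), d; split.
  exact: (d_neq0 Hgen n_gt1 l0 m0 rel lat).
move=> z; split; first exact: (pf_is_candidate Hgen n_gt1 l0 m0 rel lat).
case=> k Hk ->; apply: (pf_candidate_pf Hsg Hgen n_gt1 l0 m0 rel lat); lia.
Qed.

Lemma matrix_of_arithmetic_pf (h alpha : int) :
  i0 = 0%N :> nat -> (a i0 + 2 <= 2 * n)%N -> alpha != 0 ->
  (forall z : int, int_pseudo_frobenius H z <->
      exists2 j : nat, (1 <= j <= n - 1)%N & z = h + j%:Z * alpha) ->
  exists (s : 'S_n) (l m : 'I_n -> nat),
     (forall i : 'I_n, (0 < l i)%N /\ (0 < m i)%N) /\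
     (forall f : {mpoly K[n]},
        in_semigroup_ideal a f <-> in_minor_ideal 2 (cyclic_matrix K s l m) f).
Proof.
move=> i00 e_le al0 PFE.
have [s [l [m [k [p [q Ch]]]]]] :=
  exists_degree_chain Hsg Hgen Hleast n_ge3 al0 e_le PFE i00.
have l0 := chain_l_gt0 Ch; have m0 := chain_m_gt0 Ch; have rel := chain_rel Ch.
exists s, l, m; split=> [i|f]; first by split.
have wE i j : weight (fun i => a (s i)) (minor_exp l m i j) =
    weight (fun i => a (s i)) (minor_exp l m j i).
  by rewrite !weight_minor; have := rel i; have := rel j; lia.
split; last exact: minor_ideal_sub_kernel.
apply: kernel_sub_minor_ideal => y z E.
pose P (y0 y' : 'I_n -> nat) :=
  weight (fun i => a (s i)) y' = weight (fun i => a (s i)) y /\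
  in_minor_ideal 2 (cyclic_matrix K s l m) ('X_[monom s y0] - 'X_[monom s y']).
have red y0 : weight (fun i => a (s i)) y0 = weight (fun i => a (s i)) y ->
    exists2 y', P y0 y' & normal l m y'.
  move=> E0; apply: (normalize l0 m0 (b := fun i => a (s i))
    (h := weight (fun i => a (s i)) y) _ _ _ (y := y0)).
  - by move=> j; exact: gen_gt0 Hgen _.
  - by move=> y' [].
  - move=> i j y' ij [Ew Iy]; split.
      rewrite (weightD _ y' (minor_exp l m i j)) wE.
      by rewrite -(weightD _ y' (minor_exp l m j i)).
    rewrite -['X_[monom s y0]]
      (subrK 'X_[monom s (fun k => y' k + minor_exp l m j i k)%N]).
    rewrite -addrA; apply: idealD => //.
    rewrite (monomD s y' (minor_exp l m j i)) (monomD s y' (minor_exp l m i j)).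
    rewrite !mpolyXD -mulrBr; apply: idealM; exact: (minor_in_ideal K s l m j i).
  - by split=> //; rewrite subrr; exact: ideal0.
(* Both monomials are congruent modulo the minors to the normal form of their common degree. *)
have [y' [Ey' Iy'] ny'] := red y erefl; have [z' [Ez' Iz'] nz'] := red z (esym E).
have -> : 'X_[monom s y] - 'X_[monom s z] =
  'X_[monom s y] - 'X_[monom s y'] +
  (-1) * ('X_[monom s z] - 'X_[monom s z']) :> {mpoly K[n]}.
  have -> : y' = z'.
    apply: functional_extensionality.
    apply: (normal_unique Ch (gen_gt0 Hgen i0) _ ny' nz'); last by rewrite Ey' Ez'.
    by apply: (alpha_cancel Hsg Hgen Hleast n_ge3 al0 e_le PFE).
  by rewrite mulN1r opprB addrA subrK.
by apply: idealD => //; exact: idealM.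
Qed.

End Equivalence.

Theorem theorem1p2 (K : fieldType) (H : {pred nat}) (n : nat)
  (a : 'I_n -> nat) (i0 : 'I_n) :
  numerical_semigroup H ->
  (3 <= n)%N ->
  minimally_generated_by H a ->
  i0 = 0%N :> nat ->
  is_least_nonzero H (a i0) ->
  (a i0)%:R / 2 + 1 <= n%:R :> rat ->
  (exists (s : 'S_n) (l m : 'I_n -> nat),
     (forall i : 'I_n, (0 < l i)%N /\ (0 < m i)%N) /\
     (forall f : {mpoly K[n]},
        in_semigroup_ideal a f <-> in_minor_ideal 2 (cyclic_matrix K s l m) f))
  <->
  (exists h alpha : int,
     alpha != 0 /\
     (forall z : int,
        (exists2 p : nat, pseudo_frobenius H p & z = p%:Z) <->
        (exists2 j : nat, (1 <= j <= n - 1)%N & z = h + j%:Z * alpha))).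
Proof.
move=> Hsg n3 Hgen i00 Hleast e_le.
have pfE z := int_pseudo_frobeniusE Hgen Hleast (ltnW n3) z.
split=> [[s [l [m [lm0 IE]]]]|[h [alpha [al0 PFE]]]].
  have [h [alpha [al0 PFE]]] := arithmetic_pf_of_matrix Hsg n3 Hgen lm0 IE.
  by exists h, alpha; split=> // z; exact: iff_trans (iff_sym (pfE z)) (PFE z).
apply: (matrix_of_arithmetic_pf K Hsg n3 Hgen Hleast i00 _ al0) => [|z].
  have : (a i0)%:R + 2 <= 2 * n%:R :> rat by lra.
  by rewrite -natrD -natrM ler_nat.
exact: iff_trans (pfE z) (PFE z).
Qed.
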